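(* Let $M$ be a smooth $3$-manifold, $\nabla$ a torsion-free connection on $TM$ with projective Weyl tensor $W_{ab}{}^c{}_d$, and $\epsilon^{abc}$ an arbitrarily chosen nowhere-vanishing section of $\Lambda^3(TM)$. Put $V^{ab}{}_c=\epsilon^{dea}W_{de}{}^b{}_c$ and define the symmetric tensors $$A^{ab}=\bigodot(V^{ap}{}_qV^{bq}{}_p),\quad B^{abc}=\bigodot(V^{ap}{}_qV^{bq}{}_rV^{cr}{}_p),\quad C^{abc}=\bigodot(V^{ab}{}_pV^{pq}{}_rV^{cr}{}_q),$$ $$D^{abcd}=\bigodot(V^{ab}{}_pV^{pq}{}_rV^{cr}{}_sV^{ds}{}_q),\quad F^{abcd}=\bigodot(V^{ab}{}_pV^{cd}{}_qV^{pr}{}_sV^{qs}{}_r),$$ $$J^{abcdef}=\bigodot(V^{ab}{}_pV^{cd}{}_qV^{pq}{}_rV^{er}{}_sV^{st}{}_uV^{fu}{}_t),$$ $$K^{abcdef}=\bigodot(V^{ab}{}_pV^{cd}{}_qV^{ep}{}_rV^{fq}{}_sV^{rt}{}_uV^{su}{}_t),$$ $$L^{abcdef}=\bigodot(V^{ab}{}_pV^{cd}{}_qV^{pq}{}_rV^{rs}{}_tV^{et}{}_uV^{fu}{}_s),$$ where $\bigodot$ denotes symmetrisation over the non-contracted indices. Then each of the five tensors $$C^{abc}-2B^{abc},\quad F^{abcd}-2D^{abcd},\quad J^{abcdef}-2L^{abcdef},$$ $$3J^{abcdef}-2C^{(abc}C^{def)},\quad J^{abcdef}-4K^{abcdef}+4A^{(ab}D^{cdef)}$$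 is generally non-zero (i.e. for each of them there exist $M$ and $\nabla$ for which it is not identically zero), but all of them vanish identically if $\nabla$ is projectively equivalent to the Levi-Civita connection of some (pseudo-)Riemannian metric on $M$.
   Context: Abstract index notation is used; a repeated index denotes contraction, round brackets on indices denote symmetrisation, square brackets skew-symmetrisation. Torsion-free connections $\nabla,\hat\nabla$ on $TM$ are projectively equivalent if there is a $1$-form $\Upsilon_a$ with $\hat\nabla_aX^b=\nabla_aX^b+\Upsilon_aX^b+\delta_a{}^b\Upsilon_cX^c$ (equivalently, they have the same unparametrised geodesics). The curvature is defined by $[\nabla_a,\nabla_b]X^c=R_{ab}{}^c{}_dX^d$. It decomposes uniquely as $R_{ab}{}^c{}_d=W_{ab}{}^c{}_d+\delta_a{}^c\mathrm{P}_{bd}-\delta_b{}^c\mathrm{P}_{ad}+\beta_{ab}\delta_d{}^c$ with $\beta_{ab}=-2\mathrm{P}_{[ab]}$ and $W_{ab}{}^c{}_d$ totally trace-free; $W_{ab}{}^c{}_d$ is the projective Weyl tensor. It depends only on the projective class of $\nabla$ and satisfies $W_{ab}{}^c{}_d=W_{[ab]}{}^c{}_d$, $W_{[ab}{}^c{}_{d]}=0$, $W_{ab}{}^a{}_d=0$. Consequently $V^{ab}{}_c=V^{(ab)}{}_c$ and $V^{ab}{}_a=0$. *)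

(* Defs.v *)
From HB Require Import structures.
From mathcomp Require Import all_boot all_order all_algebra all_fingroup.
From mathcomp Require Import all_classical all_reals all_analysis.

Set Implicit Arguments.
Unset Strict Implicit.
Unset Printing Implicit Defensive.

Import Order.TTheory GRing.Theory Num.Theory.
Import numFieldNormedType.Exports.

Local Open Scope classical_set_scope.
Local Open Scope ring_scope.

(* Objects on a manifold are given by their components in the charts of an    *)
(* atlas, as functions of the coordinates x : 'rV[R]_3.  These functions are  *)
(* total; only their values on the image of the chart are meaningful.         *)

Definition partial (R : realType) (a : 'I_3) (f : 'rV[R]_3 -> R) : 'rV[R]_3 -> R :=
  fun x => 'D_(delta_mx 0 a) f x.

Fixpoint Ck (R : realType) (k : nat) (V : set 'rV[R]_3) (f : 'rV[R]_3 -> R) : Prop :=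
  (forall x, V x -> {for x, continuous f}) /\
  if k is k'.+1 then
    forall a : 'I_3, (forall x, V x -> derivable f x (delta_mx 0 a)) /\
                     Ck k' V (partial a f)
  else True.

(* To be used for open V only. *)
Definition smooth (R : realType) (V : set 'rV[R]_3) (f : 'rV[R]_3 -> R) : Prop :=
  forall k, Ck k V f.

Definition smooth_mx (R : realType) (m n : nat) (V : set 'rV[R]_3)
    (F : 'rV[R]_3 -> 'M[R]_(m, n)) : Prop :=
  forall i j, smooth V (fun x => F x i j).

Record manifold3 (R : realType) := Manifold3 {
  points :> topologicalType;
  points_hausdorff : hausdorff_space points;
  points_second_countable : @second_countable points;
  chart : Type;
  dom : chart -> set points;
  phi : chart -> points -> 'rV[R]_3;
  psi : chart -> 'rV[R]_3 -> points;
  dom_open : forall i, open (dom i);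
  dom_cover : forall p, exists i, dom i p;
  phi_open : forall i, open (phi i @` dom i);
  phiK : forall i p, dom i p -> psi i (phi i p) = p;
  phi_continuous : forall i p, dom i p -> {for p, continuous (phi i)};
  psi_continuous : forall i x, (phi i @` dom i) x -> {for x, continuous (psi i)};
  transition_smooth : forall i j,
    smooth_mx (phi i @` (dom i `&` dom j)) (phi j \o psi i) }.

Definition img (R : realType) (M : manifold3 R) (i : chart M) : set 'rV[R]_3 :=
  phi i @` dom i.

Definition overlap (R : realType) (M : manifold3 R) (i j : chart M) : set 'rV[R]_3 :=
  phi i @` (dom i `&` dom j).

Definition transition (R : realType) (M : manifold3 R) (i j : chart M) :
    'rV[R]_3 -> 'rV[R]_3 :=
  phi j \o psi i.

(* Entry (a, b) is the derivative of the b-th new coordinate in the direction *)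
(* of the a-th old one, so that vectors, as rows, transform by _ *m Jac.      *)
Definition Jac (R : realType) (M : manifold3 R) (i j : chart M) (x : 'rV[R]_3) :
    'M[R]_3 :=
  \matrix_(a, b) partial a (fun y => transition i j y 0 b) x.

Definition grad (R : realType) (f : 'rV[R]_3 -> R) (x : 'rV[R]_3) : 'cV[R]_3 :=
  \col_a partial a f x.

(* A connection on TM, as an operator on local vector fields; the entry       *)
(* (a, b) of nabla i X x is nabla_a X^b in the chart i at the point of        *)
(* coordinates x.  The field nabla_glue says that if X (in the chart i) and Y *)
(* (in the chart j) represent the same vector field over an open set U, then  *)
(* nabla X and nabla Y represent the same tensor field over U; the case i = j *)
(* is the locality of nabla.                                                  *)
Record connection (R : realType) (M : manifold3 R) := Connection {
  nabla :> chart M -> ('rV[R]_3 -> 'rV[R]_3) -> 'rV[R]_3 -> 'M[R]_3;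
  nabla_smooth : forall (i : chart M) (V : set 'rV[R]_3) X,
    open V -> V `<=` img i -> smooth_mx V X -> smooth_mx V (nabla i X);
  nabla_add : forall (i : chart M) (V : set 'rV[R]_3) X Y,
    open V -> V `<=` img i -> smooth_mx V X -> smooth_mx V Y ->
    forall x, V x -> nabla i (X \+ Y) x = nabla i X x + nabla i Y x;
  nabla_leibniz : forall (i : chart M) (V : set 'rV[R]_3) f X,
    open V -> V `<=` img i -> smooth V f -> smooth_mx V X ->
    forall x, V x ->
      nabla i (fun y => f y *: X y) x = grad f x *m X x + f x *: nabla i X x;
  nabla_glue : forall (i j : chart M) (U : set M) X Y,
    open U -> U `<=` dom i `&` dom j ->
    smooth_mx (phi i @` U) X -> smooth_mx (phi j @` U) Y ->
    (forall x, (phi i @` U) x -> X x *m Jac i j x = Y (transition i j x)) ->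
    forall x, (phi i @` U) x ->
      nabla i X x *m Jac i j x = Jac i j x *m nabla j Y (transition i j x) }.

(* nabla_X Y = X^a nabla_a Y *)
Definition cov (R : realType) (M : manifold3 R) (D : connection M) (i : chart M)
    (X Y : 'rV[R]_3 -> 'rV[R]_3) : 'rV[R]_3 -> 'rV[R]_3 :=
  fun x => X x *m D i Y x.

Definition lie_bracket (R : realType) (X Y : 'rV[R]_3 -> 'rV[R]_3) :
    'rV[R]_3 -> 'rV[R]_3 :=
  fun x => \row_b \sum_a (X x 0 a * partial a (fun y => Y y 0 b) x
                          - Y x 0 a * partial a (fun y => X y 0 b) x).

Definition torsion_free (R : realType) (M : manifold3 R) (D : connection M) : Prop :=
  forall (i : chart M) X Y, smooth_mx (img i) X -> smooth_mx (img i) Y ->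
  forall x, img i x -> cov D i X Y x - cov D i Y X x = lie_bracket X Y x.

(* One-forms are written as rows. *)
Definition is_oneform (R : realType) (M : manifold3 R)
    (u : chart M -> 'rV[R]_3 -> 'rV[R]_3) : Prop :=
  (forall i, smooth_mx (img i) (u i)) /\
  forall i j x, overlap i j x -> u i x = u j (transition i j x) *m (Jac i j x)^T.

Definition proj_equiv (R : realType) (M : manifold3 R) (D D' : connection M) : Prop :=
  exists u, is_oneform u /\
    forall (i : chart M) X, smooth_mx (img i) X ->
    forall x, img i x -> forall a b,
      D' i X x a b = D i X x a b + u i x 0 a * X x 0 b
                     + (a == b)%:R * \sum_c u i x 0 c * X x 0 c.

Definition is_metric (R : realType) (M : manifold3 R)
    (g : chart M -> 'rV[R]_3 -> 'M[R]_3) : Prop :=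
  [/\ forall i, smooth_mx (img i) (g i),
      forall i j x, overlap i j x ->
        g i x = Jac i j x *m g j (transition i j x) *m (Jac i j x)^T,
      forall i x, img i x -> (g i x)^T = g i x &
      forall i x, img i x -> g i x \in unitmx].

Definition inner (R : realType) (G : 'M[R]_3) (v w : 'rV[R]_3) : R :=
  (v *m G *m w^T) 0 0.

Definition metric_compatible (R : realType) (M : manifold3 R) (D : connection M)
    (g : chart M -> 'rV[R]_3 -> 'M[R]_3) : Prop :=
  forall (i : chart M) X Y, smooth_mx (img i) X -> smooth_mx (img i) Y ->
  forall x, img i x -> forall a,
    partial a (fun y => inner (g i y) (X y) (Y y)) x
    = inner (g i x) (row a (D i X x)) (Y x) + inner (g i x) (X x) (row a (D i Y x)).

Definition levi_civita (R : realType) (M : manifold3 R)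
    (g : chart M -> 'rV[R]_3 -> 'M[R]_3) (D : connection M) : Prop :=
  torsion_free D /\ metric_compatible D g.

Definition proj_metrizable (R : realType) (M : manifold3 R) (D : connection M) : Prop :=
  exists g D', [/\ is_metric g, levi_civita g D' & proj_equiv D D'].

(* T a b c d is the component T_{ab}^c_d. *)
Definition comp4 (R : realType) := 'I_3 -> 'I_3 -> 'I_3 -> 'I_3 -> R.

(* For a torsion-free connection, X^a Y^b [nabla_a, nabla_b] Z is             *)
(* nabla_X nabla_Y Z - nabla_Y nabla_X Z - nabla_[X,Y] Z.                     *)
Definition is_curvature (R : realType) (M : manifold3 R) (D : connection M)
    (Rm : chart M -> 'rV[R]_3 -> comp4 R) : Prop :=
  forall (i : chart M) X Y Z,
    smooth_mx (img i) X -> smooth_mx (img i) Y -> smooth_mx (img i) Z ->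
  forall x, img i x -> forall c,
    (cov D i X (cov D i Y Z) x - cov D i Y (cov D i X Z) x
     - cov D i (lie_bracket X Y) Z x) 0 c
    = \sum_a \sum_b \sum_d Rm i x a b c d * X x 0 a * Y x 0 b * Z x 0 d.

Definition trace_free (R : realType) (T : comp4 R) : Prop :=
  [/\ forall b d, \sum_a T a b a d = 0,
      forall a d, \sum_b T a b b d = 0 &
      forall a b, \sum_c T a b c c = 0].

Definition is_weyl (R : realType) (M : manifold3 R) (D : connection M)
    (W : chart M -> 'rV[R]_3 -> comp4 R) : Prop :=
  exists (Rm : chart M -> 'rV[R]_3 -> comp4 R) (P : chart M -> 'rV[R]_3 -> 'M[R]_3),
    is_curvature D Rm /\
    forall (i : chart M) x, img i x ->
      trace_free (W i x) /\
      forall a b c d,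
        let beta := P i x b a - P i x a b in
        Rm i x a b c d = W i x a b c d + (a == c)%:R * P i x b d
                         - (b == c)%:R * P i x a d + beta * (d == c)%:R.

Definition comp3 (R : realType) := 'I_3 -> 'I_3 -> 'I_3 -> R.

(* Nowhere-vanishing smooth sections of the third exterior power of TM. *)
Definition is_volume (R : realType) (M : manifold3 R)
    (eps : chart M -> 'rV[R]_3 -> comp3 R) : Prop :=
  [/\ forall i a b c, smooth (img i) (fun x => eps i x a b c),
      forall i j x, overlap i j x -> forall a' b' c',
        eps j (transition i j x) a' b' c'
        = \sum_a \sum_b \sum_c
            eps i x a b c * Jac i j x a a' * Jac i j x b b' * Jac i j x c c',
      forall i x, img i x -> forall a b c,
        eps i x b a c = - eps i x a b c /\ eps i x a c b = - eps i x a b c &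
      forall i x, img i x -> exists a b c, eps i x a b c != 0].

(* V a b c is the component V^{ab}_c. *)
Definition Vtensor (R : realType) (eps : comp3 R) (W : comp4 R) : comp3 R :=
  fun a b c => \sum_d \sum_e eps d e a * W d e b c.

(* Contravariant tensors of rank k at a point. *)
Definition ctensor (R : realType) (k : nat) := k.-tuple 'I_3 -> R.

Definition symm (R : realType) (k : nat) (T : ctensor R k) : ctensor R k :=
  fun t => (k`!)%:R^-1 * \sum_(s : 'S_k) T [tuple tnth t (s i) | i < k].

Definition tA (R : realType) (V : comp3 R) : ctensor R 2 := symm (fun t =>
  let a := t`_0 in let b := t`_1 in
  \sum_p \sum_q V a p q * V b q p).

Definition tB (R : realType) (V : comp3 R) : ctensor R 3 := symm (fun t =>
  let a := t`_0 in let b := t`_1 in let c := t`_2 in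
  \sum_p \sum_q \sum_r V a p q * V b q r * V c r p).

Definition tC (R : realType) (V : comp3 R) : ctensor R 3 := symm (fun t =>
  let a := t`_0 in let b := t`_1 in let c := t`_2 in
  \sum_p \sum_q \sum_r V a b p * V p q r * V c r q).

Definition tD (R : realType) (V : comp3 R) : ctensor R 4 := symm (fun t =>
  let a := t`_0 in let b := t`_1 in let c := t`_2 in let d := t`_3 in
  \sum_p \sum_q \sum_r \sum_s V a b p * V p q r * V c r s * V d s q).

Definition tF (R : realType) (V : comp3 R) : ctensor R 4 := symm (fun t =>
  let a := t`_0 in let b := t`_1 in let c := t`_2 in let d := t`_3 in
  \sum_p \sum_q \sum_r \sum_s V a b p * V c d q * V p r s * V q s r).

Definition tJ (R : realType) (V : comp3 R) : ctensor R 6 := symm (fun m =>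
  let a := m`_0 in let b := m`_1 in let c := m`_2 in
  let d := m`_3 in let e := m`_4 in let f := m`_5 in
  \sum_p \sum_q \sum_r \sum_s \sum_t \sum_u
    V a b p * V c d q * V p q r * V e r s * V s t u * V f u t).

Definition tK (R : realType) (V : comp3 R) : ctensor R 6 := symm (fun m =>
  let a := m`_0 in let b := m`_1 in let c := m`_2 in
  let d := m`_3 in let e := m`_4 in let f := m`_5 in
  \sum_p \sum_q \sum_r \sum_s \sum_t \sum_u
    V a b p * V c d q * V e p r * V f q s * V r t u * V s u t).

Definition tL (R : realType) (V : comp3 R) : ctensor R 6 := symm (fun m =>
  let a := m`_0 in let b := m`_1 in let c := m`_2 in
  let d := m`_3 in let e := m`_4 in let f := m`_5 in
  \sum_p \sum_q \sum_r \sum_s \sum_t \sum_u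
    V a b p * V c d q * V p q r * V r s t * V e t u * V f u s).

Definition CB (R : realType) (V : comp3 R) : ctensor R 3 :=
  fun t => tC V t - 2 * tB V t.

Definition FD (R : realType) (V : comp3 R) : ctensor R 4 :=
  fun t => tF V t - 2 * tD V t.

Definition JL (R : realType) (V : comp3 R) : ctensor R 6 :=
  fun t => tJ V t - 2 * tL V t.

Definition JCC (R : realType) (V : comp3 R) : ctensor R 6 :=
  fun t => 3 * tJ V t
    - 2 * symm (fun m : 6.-tuple 'I_3 =>
                  tC V [tuple m`_0; m`_1; m`_2] * tC V [tuple m`_3; m`_4; m`_5]) t.

Definition JKAD (R : realType) (V : comp3 R) : ctensor R 6 :=
  fun t => tJ V t - 4 * tK V t
    + 4 * symm (fun m : 6.-tuple 'I_3 =>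
                  tA V [tuple m`_0; m`_1] * tD V [tuple m`_2; m`_3; m`_4; m`_5]) t.

Definition vanishes (R : realType) (k : nat) (T : comp3 R -> ctensor R k)
    (M : manifold3 R) (eps : chart M -> 'rV[R]_3 -> comp3 R)
    (W : chart M -> 'rV[R]_3 -> comp4 R) : Prop :=
  forall (i : chart M) x, img i x -> forall t, T (Vtensor (eps i x) (W i x)) t = 0.

(* The choice of eps is arbitrary, hence the universal quantification; the    *)
(* existence of some eps keeps it from being vacuous.                         *)
Definition generally_nonzero (R : realType) (k : nat) (T : comp3 R -> ctensor R k) : Prop :=
  exists (M : manifold3 R) (D : connection M) (W : chart M -> 'rV[R]_3 -> comp4 R),
    [/\ torsion_free D, is_weyl D W, exists eps, @is_volume R M eps &
        forall eps, @is_volume R M eps -> ~ vanishes T eps W].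

(* Main.v *)
Require Import Defs.
From mathcomp Require Import all_boot all_order all_algebra all_fingroup.
From mathcomp Require Import all_classical all_reals all_analysis.
From mathcomp Require Import ring lra.

(** Why the theorem holds.  A symmetric tensor T vanishes as soon as its
    polynomial T(x) = T^{a...f} x_a ... x_f on covectors does (symmetric_eq0),
    so each of the five tensors is studied through that polynomial.  Put
    N(u)^b_c = u_a V^{ab}_c, a matrix depending linearly on the covector u, and
    w = x N(x).  Contracting with x turns every tensor of the statement into the
    trace of a product of matrices N(x), N(w), ... (hat_tA up to hat_tK); for
    instance A(x) = tr N(x)^2 and C(x) = tr (N(w) N(x)).

    Vanishing.  Let the connection be projectively equivalent to the
    Levi-Civita connection of g.  A projective change alters the curvature only by
    terms of the shape allowed in the decomposition that defines W
    (riemann_proj), so W is also the trace-free part of the Levi-Civita curvature.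
    The latter, with its upper index lowered, is skew in both pairs of indices:
    in the first by definition, in the second because second derivatives of g
    commute (riemann_skew, which rests on derive_comm).  In dimension 3 it is
    therefore eps_{abi} eps_{cdj} E^{ij}, and the Bianchi identity makes E symmetric
    (curvature_dual).  Removing traces gives, up to a scalar absorbed in E,
          V^{ab}_c = (E^{aj} h^{bm} + E^{bj} h^{am}) eps_{mcj},   h = g^{-1}
    (metric_weyl).  So V is a skew bilinear function of the two quadratic forms E
    and h: it is determined by E /\ h, and the five tensors are invariants that
    vanish on decomposable bivectors E /\ h.  Since the construction is
    equivariant under linear changes of frame (contr_pencil_transform), it is
    enough to evaluate the polynomials at the first basis covector, where they
    become polynomial identities in the twelve components of E and h
    (pencil_forms_e0).

    Non-vanishing.  On R^3 take the connection with constant Christoffel symbols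
    Gamma_{01}^1 = Gamma_{10}^1 = Gamma_{12}^0 = Gamma_{21}^0 = 1 and zero
    otherwise.  If eps has component f in the coordinates, then for x = e^0 the
    matrix N(x) is f diag(-2, 2, 0) and x is an eigenvector with eigenvalue
    l = -2 f.  Hence w = l x, all the traces reduce to tr N(x)^2 = 8 f^2 and
    tr N(x)^3 = 0 (forms_eigen), and the five polynomials take the values
    -16 f^3, 32 f^4, 128 f^6, -128 f^6 and -384 f^6. *)

Set Implicit Arguments.
Unset Strict Implicit.
Unset Printing Implicit Defensive.

Import Order.TTheory GRing.Theory Num.Theory.
Import numFieldNormedType.Exports.

Local Open Scope classical_set_scope.
Local Open Scope ring_scope.

(** * Sums and case analysis over three indices *)

(* Ordinals in constructor form, so that tests and matches on them compute. *)
Local Notation i0 := (@Ordinal 3 0 isT).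
Local Notation i1 := (@Ordinal 3 1 isT).
Local Notation i2 := (@Ordinal 3 2 isT).

Lemma ord3_ind (P : 'I_3 -> Prop) : P i0 -> P i1 -> P i2 -> forall a, P a.
Proof.
move=> P0 P1 P2 [[|[|[|//]]] lt3].
- by have -> : Ordinal lt3 = i0 by exact: val_inj.
- by have -> : Ordinal lt3 = i1 by exact: val_inj.
- by have -> : Ordinal lt3 = i2 by exact: val_inj.
Qed.

Lemma sum3 (V : nmodType) (F : 'I_3 -> V) : \sum_a F a = F i0 + F i1 + F i2.
Proof.
rewrite !big_ord_recl big_ord0 addr0 addrA; congr (_ + _ + _); congr F; exact: val_inj.
Qed.

(** * Symmetric tensors and their polynomials *)

Section Polarisation.
Variable R : realType.

(** The polynomial T(x), a sum over all index tuples: for T of rank k it is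
    homogeneous of degree k in x. *)
Definition hat (k : nat) (T : ctensor R k) (x : 'rV[R]_3) : R :=
  \sum_(t : k.-tuple 'I_3) T t * \prod_(i < k) x 0 (tnth t i).

Lemma hat_perm k (T : ctensor R k) (s : 'S_k) x :
  hat (fun t => T [tuple tnth t (s i) | i < k]) x = hat T x.
Proof.
pose h (u : 'S_k) (t : k.-tuple 'I_3) := [tuple tnth t (u i) | i < k].
rewrite /hat [RHS](reindex (h s)) /=.
  apply: eq_bigr => t _; congr (_ * _).
  rewrite [LHS](reindex_inj (@perm_inj _ s)).
  by apply: eq_bigr => i _; rewrite tnth_mktuple.
exists (h s^-1%g) => t _; apply: eq_from_tnth => i;
  by rewrite !tnth_mktuple ?permK ?permKV.
Qed.

Lemma hat_symm k (T : ctensor R k) x : hat (symm T) x = hat T x.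
Proof.
rewrite {1}/hat /symm.
under eq_bigr do rewrite -mulrA mulr_suml.
rewrite -mulr_sumr exchange_big /=.
rewrite (eq_bigr (fun=> hat T x)); last by move=> s _; exact: hat_perm.
rewrite sumr_const card_Sn -[hat T x *+ _]mulr_natl mulrA mulVf ?mul1r//.
Qed.

(** Polarisation.  The polynomial is evaluated at the covectors whose entries
    count how often an index occurs among the t_i, i in S, for S a set of positions:
    this gives the sum of T (t o f) over the maps f with image in S.  By induction
    on S the sum over the maps with image exactly S vanishes as well; for S the
    full set these maps are the permutations. *)
Lemma symm_eq0 k (T : ctensor R k) :
  (forall x, hat T x = 0) -> forall t, symm T t = 0.
Proof.
move=> T0 t; pose F (f : {ffun 'I_k -> 'I_k}) := T [tuple tnth t (f i) | i < k].
have F0 (S : {set 'I_k}) :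
    \sum_(f : {ffun 'I_k -> 'I_k} | [set f i | i in 'I_k]%SET \subset S) F f = 0.
  rewrite -[RHS](T0 (\row_j \sum_(i in S) (tnth t i == j)%:R)) /hat.
  under [RHS]eq_bigr => m _.
    under eq_bigr do rewrite mxE.
    rewrite (bigA_distr_big _ (fun i j => (tnth t j == tnth m i)%:R)) mulr_sumr.
    over.
  rewrite exchange_big /= big_mkcond /= [RHS]big_mkcond.
  apply: eq_bigr => f _.
  have -> : ([set f i | i in 'I_k]%SET \subset S) = (f \in ffun_on (mem S)).
    apply/fintype.subsetP/ffun_onP => [sfS i|fS _ /imsetP[i _ ->]]; last exact: fS.
    by apply: sfS; apply: imset_f.
  case: ifP => // _.
  rewrite (bigD1 [tuple tnth t (f i) | i < k]) //= big1 ?mulr1; last first.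
    by move=> i _; rewrite tnth_mktuple eqxx.
  rewrite [X in _ + X]big1 ?addr0// => m mf.
  have [i fi] : exists i, tnth m i != tnth t (f i).
    apply/existsP; apply: contraR mf; rewrite negb_exists => /forallP eqm.
    apply/eqP/eq_from_tnth => i; rewrite tnth_mktuple.
    by apply/eqP; have := eqm i; rewrite negbK.
  by rewrite (bigD1 i) //= eq_sym (negPf fi) mul0r mulr0.
have {}F0 n (S : {set 'I_k}) : (#|S| < n)%N ->
    \sum_(f : {ffun 'I_k -> 'I_k} | [set f i | i in 'I_k]%SET == S) F f = 0.
  elim: n S => // n IHn S leSn.
  rewrite -[RHS](F0 S) [RHS](partition_big (fun f : {ffun 'I_k -> 'I_k} =>
    [set f i | i in 'I_k]%SET) (fun S' : {set 'I_k} => S' \subset S)) //=.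
  rewrite (bigD1 S) //= [X in _ + X]big1 ?addr0 => [|S' /andP[sS'S neqS]].
    apply: eq_bigl => f; case: eqP => [->|]; by rewrite ?fintype.subxx ?andbF.
  rewrite -[RHS](IHn S'); last first.
    rewrite -ltnS; apply: leq_trans leSn; rewrite ltnS proper_card//.
    by rewrite finset.properEneq neqS.
  by apply: eq_bigl => f; case: eqP => [->|]; rewrite ?sS'S ?andbF.
rewrite /symm; apply/eqP; rewrite mulf_eq0; apply/orP; right; apply/eqP.
rewrite -[RHS](F0 k.+1 [set: 'I_k]%SET); last by rewrite cardsT card_ord.
rewrite [RHS](eq_bigl (fun f : {ffun 'I_k -> 'I_k} => injectiveb f)); last first.
  move=> f; apply/eqP/injectiveP => [fT | inj_f].
    have /imset_injP injf : #|[set f i | i in 'I_k]%SET| == #|'I_k| by rewrite fT cardsT.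
    by move=> i j fij; apply: injf.
  by apply/eqP; rewrite eqEcard finset.subsetT cardsT card_imset /= ?leqnn.
rewrite [RHS](reindex (@pval _)) /=; last first.
  pose in_Sk := insubd (1%g : 'S_k).
  by exists in_Sk => /= f injf; first apply: val_inj; apply: insubdK.
apply: eq_big => [s|s _]; first by rewrite (valP s).
by congr T; apply: eq_from_tnth => i; rewrite !tnth_mktuple pvalE.
Qed.

Lemma hat0 (T : ctensor R 0) x : hat T x = T [tuple].
Proof.
rewrite /hat (big_pred1 [tuple]) ?big_ord0 ?mulr1// => t.
by apply/esym/eqP/val_inj; case: t => -[].
Qed.

Lemma hatS k (T : ctensor R k.+1) x :
  hat T x = \sum_a x 0 a * hat (fun t => T (cons_tuple a t)) x.
Proof.
rewrite /hat; under [RHS]eq_bigr do rewrite mulr_sumr.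
rewrite pair_bigA /= (reindex (fun p : 'I_3 * k.-tuple 'I_3 => cons_tuple p.1 p.2)) /=.
  apply: eq_bigr => -[a t] _ /=; rewrite big_ord_recl tnth0 mulrCA; congr (_ * (_ * _)).
  by apply: eq_bigr => i _; rewrite tnthS.
exists (fun t => (thead t, behead_tuple t)) => [[a t] _|t _] /=.
  by rewrite theadE; congr (_, _); apply: val_inj.
by rewrite [RHS]tuple_eta; apply: val_inj.
Qed.
End Polarisation.

(** * Contraction with a covector *)

Section Contraction.
Variable R : comNzRingType.

Definition contr (V : 'I_3 -> 'I_3 -> 'I_3 -> R) (w : 'rV[R]_3) : 'M[R]_3 :=
  \matrix_(b, c) \sum_a w 0 a * V a b c.

Section Forms.
Variables (N : 'rV[R]_3 -> 'M[R]_3) (x : 'rV[R]_3).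
Let w := x *m N x.
(* The polynomials of the tensors A, ..., L, in terms of N = contr V. *)
Definition formA := \tr (N x *m N x).
Definition formB := \tr (N x *m (N x *m N x)).
Definition formC := \tr (N w *m N x).
Definition formD := \tr (N w *m (N x *m N x)).
Definition formF := \tr (N w *m N w).
Definition formJ := \tr (N (w *m N w *m N x) *m N x).
Definition formK := \tr (N (w *m N x) *m N (w *m N x)).
Definition formL := \tr (N (w *m N w) *m (N x *m N x)).
End Forms.

Definition levi (a b c : nat) : R :=
  match a, b, c with
  | 0, 1, 2 | 1, 2, 0 | 2, 0, 1 => 1
  | 0, 2, 1 | 2, 1, 0 | 1, 0, 2 => -1
  | _, _, _ => 0
  end.

(** The tensor V attached to two quadratic forms E and G on covectors; when
    both are symmetric it changes sign if E and G are exchanged, so it only depends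
    on the pencil they span and on a volume element. *)
Definition pencil (E G : 'M[R]_3) := fun a b c : 'I_3 =>
  \sum_m \sum_j (E a j * G m b + E b j * G m a) * levi m c j.

End Contraction.

Section HatFormulas.
Variables (R : realType) (V : comp3 R) (x : 'rV[R]_3).
Let n := contr V x.
Let w := x *m n.

Definition pairing (u : 'rV[R]_3) (f : 'I_3 -> R) := \sum_a u 0 a * f a.

Lemma pairingC u v (f : 'I_3 -> 'I_3 -> R) :
  pairing u (fun a => pairing v (f a)) = pairing v (fun b => pairing u (f^~ b)).
Proof.
rewrite /pairing; under eq_bigr do rewrite mulr_sumr.
rewrite exchange_big; apply: eq_bigr => b _; rewrite mulr_sumr.
by apply: eq_bigr => a _; rewrite mulrCA.
Qed.

Lemma pairing_mul u (B : 'M[R]_3) f :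
  pairing (u *m B) f = pairing u (fun a => \sum_b B a b * f b).
Proof.
rewrite /pairing; under eq_bigr do rewrite mxE mulr_suml.
rewrite exchange_big; apply: eq_bigr => a _; rewrite mulr_sumr.
by apply: eq_bigr => b _; rewrite mulrA.
Qed.

Lemma contr_mul u b f :
  \sum_c contr V u b c * f c = pairing u (fun a => \sum_c V a b c * f c).
Proof.
rewrite /pairing; under eq_bigr do rewrite mxE mulr_suml.
rewrite exchange_big; apply: eq_bigr => a _; rewrite mulr_sumr.
by apply: eq_bigr => c _; rewrite mulrA.
Qed.

Lemma tr_contr u (B : 'M[R]_3) :
  \tr (contr V u *m B) = pairing u (fun a => \sum_b \sum_c V a b c * B c b).
Proof.
rewrite /pairing; under [RHS]eq_bigr do rewrite mulr_sumr.
rewrite exchange_big; apply: eq_bigr => b _.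
by rewrite mxE contr_mul; apply: eq_bigr.
Qed.

Lemma tr_contr_r u (B : 'I_3 -> 'I_3 -> R) :
  \sum_b \sum_c B b c * contr V u c b
  = pairing u (fun a => \sum_b \sum_c B b c * V a c b).
Proof.
rewrite /pairing; under [RHS]eq_bigr do rewrite mulr_sumr.
rewrite [RHS]exchange_big; apply: eq_bigr => b _.
under [RHS]eq_bigr do rewrite mulr_sumr.
rewrite [RHS]exchange_big; apply: eq_bigr => c _.
by rewrite mxE mulr_sumr; apply: eq_bigr => a _; rewrite mulrCA.
Qed.

Lemma pairing_sum u (f : 'I_3 -> R) (g : 'I_3 -> 'I_3 -> R) :
  \sum_r f r * pairing u (g r) = pairing u (fun q => \sum_r f r * g r q).
Proof.
rewrite /pairing; under eq_bigr do rewrite mulr_sumr.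
rewrite exchange_big; apply: eq_bigr => q _; rewrite mulr_sumr.
by apply: eq_bigr => r _; rewrite mulrCA.
Qed.

Lemma hat_sum k (T : 'I_3 -> ctensor R k) :
  hat (fun t => \sum_p T p t) x = \sum_p hat (T p) x.
Proof. by rewrite /hat exchange_big; apply: eq_bigr => t _; rewrite mulr_suml. Qed.

(** One contraction with x moves onto the only factor that carries its index;
    applied once per free index, this factors the polynomial of a product. *)
Lemma sum_pull (f g : 'I_3 -> R) k :
  (forall a, g a = f a * k) -> \sum_a x 0 a * g a = (\sum_a x 0 a * f a) * k.
Proof.
by move=> gE; rewrite mulr_suml; apply: eq_bigr => a _; rewrite gE mulrA.
Qed.

Lemma nE b c : n b c = \sum_a x 0 a * V a b c. Proof. by rewrite mxE. Qed.

Lemma wE p : w 0 p = \sum_a x 0 a * \sum_b x 0 b * V a b p.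
Proof.
rewrite mxE; under eq_bigr do rewrite nE mulr_sumr.
rewrite exchange_big; apply: eq_bigr => a _; rewrite mulr_sumr.
by apply: eq_bigr => b _; rewrite mulrCA.
Qed.

Lemma hat2 (T : ctensor R 2) :
  hat T x = \sum_a x 0 a * \sum_b x 0 b * T (cons_tuple a (cons_tuple b [tuple])).
Proof.
rewrite hatS; apply: eq_bigr => a _; congr (_ * _).
by rewrite hatS; apply: eq_bigr => b _; rewrite hat0.
Qed.

Lemma hat3 (T : ctensor R 3) :
  hat T x = \sum_a x 0 a * \sum_b x 0 b * \sum_c x 0 c *
    T (cons_tuple a (cons_tuple b (cons_tuple c [tuple]))).
Proof.
by rewrite hatS; apply: eq_bigr => a _; congr (_ * _); rewrite hat2.
Qed.

Lemma hat4 (T : ctensor R 4) :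
  hat T x = \sum_a x 0 a * \sum_b x 0 b * \sum_c x 0 c * \sum_d x 0 d *
    T (cons_tuple a (cons_tuple b (cons_tuple c (cons_tuple d [tuple])))).
Proof.
by rewrite hatS; apply: eq_bigr => a _; congr (_ * _); rewrite hat3.
Qed.

Lemma hat6 (T : ctensor R 6) :
  hat T x = \sum_a x 0 a * \sum_b x 0 b * \sum_c x 0 c * \sum_d x 0 d *
    \sum_e x 0 e * \sum_f x 0 f *
    T (cons_tuple a (cons_tuple b (cons_tuple c (cons_tuple d
        (cons_tuple e (cons_tuple f [tuple])))))).
Proof.
rewrite hatS; apply: eq_bigr => a _; congr (_ * _).
by rewrite hatS; apply: eq_bigr => b _; rewrite hat4.
Qed.

Lemma hat_tA : hat (tA V) x = formA (contr V) x.
Proof.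
rewrite hat_symm hat_sum; apply: eq_bigr => p _; rewrite mxE hat_sum.
apply: eq_bigr => q _; rewrite hat2 !nE.
apply: sum_pull => a; rewrite [RHS]mulrC; apply: sum_pull => b; exact: mulrC.
Qed.

Lemma hat_tB : hat (tB V) x = formB (contr V) x.
Proof.
rewrite hat_symm hat_sum /formB; apply: eq_bigr => p _; rewrite mxE hat_sum.
apply: eq_bigr => q _; rewrite hat_sum [X in _ * X]mxE mulr_sumr.
apply: eq_bigr => r _; rewrite hat3 !nE.
apply: sum_pull => a; rewrite [RHS]mulrC -mulrA.
by apply: sum_pull => b; rewrite [RHS]mulrC -mulrA; apply: sum_pull => c /=; ring.
Qed.

Lemma hat_tC : hat (tC V) x = formC (contr V) x.
Proof.
rewrite /formC tr_contr hat_symm hat_sum; apply: eq_bigr => p _; rewrite mulr_sumr hat_sum.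
apply: eq_bigr => q _; rewrite mulr_sumr hat_sum.
apply: eq_bigr => r _; rewrite hat3 -/n wE.
apply: sum_pull => a; apply: sum_pull => b; rewrite nE mulrA [RHS]mulrC.
by apply: sum_pull => c /=; ring.
Qed.

Lemma hat_tD : hat (tD V) x = formD (contr V) x.
Proof.
rewrite /formD tr_contr hat_symm hat_sum.
apply: eq_bigr => p _; rewrite mulr_sumr hat_sum.
apply: eq_bigr => q _; rewrite mulr_sumr hat_sum.
apply: eq_bigr => r _; rewrite [X in _ * (_ * X)]mxE !mulr_sumr hat_sum.
apply: eq_bigr => s _; rewrite hat4 -/n wE.
apply: sum_pull => a; apply: sum_pull => b.
rewrite [RHS](_ : _ = n r s * (V a b p * V p q r * n s q)); last ring.
rewrite [in RHS]nE; apply: sum_pull => c.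
rewrite [RHS](_ : _ = n s q * (V c r s * V a b p * V p q r)); last ring.
by rewrite nE; apply: sum_pull => d /=; ring.
Qed.

Lemma hat_tF : hat (tF V) x = formF (contr V) x.
Proof.
rewrite /formF tr_contr hat_symm hat_sum.
apply: eq_bigr => p _; rewrite tr_contr_r mulr_sumr hat_sum.
apply: eq_bigr => q _; rewrite mulrA mulr_sumr hat_sum.
apply: eq_bigr => r _; rewrite mulr_sumr hat_sum.
apply: eq_bigr => s _; rewrite hat4 -/n !wE -mulrA.
apply: sum_pull => a; apply: sum_pull => b; rewrite mulrCA.
apply: sum_pull => c; apply: sum_pull => d /=; ring.
Qed.

Lemma hat_tJ : hat (tJ V) x = formJ (contr V) x.
Proof.
rewrite /formJ -/n -/w tr_contr 2!pairing_mul hat_symm hat_sum.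
under [X in pairing _ X]funext do rewrite (contr_mul w).
rewrite pairingC; apply: eq_bigr => p _; rewrite hat_sum mulr_sumr.
apply: eq_bigr => q _; rewrite hat_sum mulrA mulr_sumr.
apply: eq_bigr => r _; rewrite hat_sum !mulr_sumr.
apply: eq_bigr => s _; rewrite hat_sum !mulr_sumr.
apply: eq_bigr => t _; rewrite hat_sum !mulr_sumr.
apply: eq_bigr => u _; rewrite hat6. rewrite !wE -mulrA.
apply: sum_pull => a; apply: sum_pull => b; rewrite mulrCA.
apply: sum_pull => c; apply: sum_pull => d.
rewrite [RHS](_ : _ = n r s * (V c d q * V a b p * V p q r * V s t u * n u t)); last ring.
rewrite [in RHS]nE; apply: sum_pull => e; rewrite [RHS](_ : _ = n u t *
  (V e r s * V c d q * V a b p * V p q r * V s t u)); last ring.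
by rewrite nE; apply: sum_pull => f /=; ring.
Qed.

Lemma hat_tL : hat (tL V) x = formL (contr V) x.
Proof.
rewrite /formL -/n -/w tr_contr pairing_mul hat_symm hat_sum.
under [X in pairing _ X]funext do rewrite (contr_mul w).
rewrite pairingC; apply: eq_bigr => p _; rewrite hat_sum mulr_sumr.
apply: eq_bigr => q _; rewrite hat_sum mulrA mulr_sumr.
apply: eq_bigr => r _; rewrite hat_sum !mulr_sumr.
apply: eq_bigr => s _; rewrite hat_sum !mulr_sumr.
apply: eq_bigr => t _; rewrite hat_sum [X in _ * (_ * (_ * X))]mxE !mulr_sumr.
apply: eq_bigr => u _; rewrite hat6 !wE -mulrA.
apply: sum_pull => a; apply: sum_pull => b; rewrite mulrCA.
apply: sum_pull => c; apply: sum_pull => d.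
rewrite [RHS](_ : _ = n t u * (V c d q * V a b p * V p q r * V r s t * n u s)); last ring.
rewrite [in RHS]nE; apply: sum_pull => e; rewrite [RHS](_ : _ = n u s *
  (V e t u * V c d q * V a b p * V p q r * V r s t)); last ring.
by rewrite nE; apply: sum_pull => f /=; ring.
Qed.

Lemma hat_tK : hat (tK V) x = formK (contr V) x.
Proof.
rewrite /formK -/n -/w tr_contr pairing_mul hat_symm hat_sum.
apply: eq_bigr => p _; rewrite hat_sum.
under [X in _ * X]eq_bigr do rewrite tr_contr_r pairing_mul.
rewrite pairing_sum mulr_sumr.
apply: eq_bigr => q _; rewrite hat_sum mulrA mulr_sumr.
apply: eq_bigr => r _; rewrite hat_sum !mulr_sumr.
apply: eq_bigr => s _; rewrite hat_sum !mulr_sumr.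
apply: eq_bigr => t _; rewrite hat_sum !mulr_sumr.
apply: eq_bigr => u _; rewrite hat6 !wE -mulrA.
apply: sum_pull => a; apply: sum_pull => b; rewrite mulrCA.
apply: sum_pull => c; apply: sum_pull => d.
rewrite [RHS](_ : _ = n p r * (V c d q * V a b p * V r t u * V s u t * n q s)); last ring.
rewrite [in RHS]nE; apply: sum_pull => e; rewrite [RHS](_ : _ = n q s *
  (V e p r * V c d q * V a b p * V r t u * V s u t)); last ring.
by rewrite nE; apply: sum_pull => f /=; ring.
Qed.

End HatFormulas.

Section Tensors.
Variable R : realType.

Definition symmetric k (T : ctensor R k) :=
  forall (s : 'S_k) t, T [tuple tnth t (s i) | i < k] = T t.

Lemma symm_symmetric k (T : ctensor R k) : symmetric (symm T).
Proof.
move=> s t; congr (_ * _); rewrite [RHS](reindex_inj (@mulIg _ s)) /=.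
apply: eq_bigr => u _; congr T; apply: eq_from_tnth => i.
by rewrite !tnth_mktuple permM.
Qed.

Lemma symmetric_eq0 k (T : ctensor R k) :
  symmetric T -> (forall x, hat T x = 0) -> forall t, T t = 0.
Proof.
move=> Tsym T0 t; rewrite -[RHS](symm_eq0 T0 t) /symm.
under eq_bigr do rewrite Tsym.
by rewrite sumr_const card_Sn -[T t *+ _]mulr_natl mulrA mulVf ?mul1r//
  pnatr_eq0 -lt0n fact_gt0.
Qed.

(** Symmetrising does not change the polynomial, and the slots of the two factors
    are contracted independently. *)
Lemma hat_mul33 (T U : ctensor R 3) x :
  hat (symm (fun m : 6.-tuple 'I_3 =>
    T [tuple m`_0; m`_1; m`_2] * U [tuple m`_3; m`_4; m`_5])) x = hat T x * hat U x.
Proof.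
rewrite hat_symm hat6 !hat3.
apply: sum_pull => a; apply: sum_pull => b; apply: sum_pull => c; rewrite [RHS]mulrC.
apply: sum_pull => d; apply: sum_pull => e; apply: sum_pull => f.
by rewrite mulrC; congr (U _ * T _); exact: val_inj.
Qed.

Lemma hat_mul24 (T : ctensor R 2) (U : ctensor R 4) x :
  hat (symm (fun m : 6.-tuple 'I_3 =>
    T [tuple m`_0; m`_1] * U [tuple m`_2; m`_3; m`_4; m`_5])) x = hat T x * hat U x.
Proof.
rewrite hat_symm hat6 !hat2 hat4.
apply: sum_pull => a; apply: sum_pull => b; rewrite [RHS]mulrC.
apply: sum_pull => c; apply: sum_pull => d; apply: sum_pull => e; apply: sum_pull => f.
by rewrite mulrC; congr (U _ * T _); exact: val_inj.
Qed.

Variable V : comp3 R.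
Let N := contr V.

Lemma hat_CB x : hat (CB V) x = formC N x - 2 * formB N x.
Proof.
rewrite -hat_tC -hat_tB /hat mulr_sumr -sumrB.
by apply: eq_bigr => t _; rewrite /CB; ring.
Qed.

Lemma hat_FD x : hat (FD V) x = formF N x - 2 * formD N x.
Proof.
rewrite -hat_tF -hat_tD /hat mulr_sumr -sumrB.
by apply: eq_bigr => t _; rewrite /FD; ring.
Qed.

Lemma hat_JL x : hat (JL V) x = formJ N x - 2 * formL N x.
Proof.
rewrite -hat_tJ -hat_tL /hat mulr_sumr -sumrB.
by apply: eq_bigr => t _; rewrite /JL; ring.
Qed.

Lemma hat_JCC x : hat (JCC V) x = 3 * formJ N x - 2 * formC N x ^+ 2.
Proof.
rewrite -hat_tJ -hat_tC expr2 -hat_mul33 /hat !mulr_sumr -sumrB.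
by apply: eq_bigr => t _; rewrite /JCC; ring.
Qed.

Lemma hat_JKAD x : hat (JKAD V) x = formJ N x - 4 * formK N x + 4 * (formA N x * formD N x).
Proof.
rewrite -hat_tJ -hat_tK -hat_tA -hat_tD -hat_mul24 /hat !mulr_sumr -sumrB -big_split.
by apply: eq_bigr => t _; rewrite /JKAD /=; ring.
Qed.

Lemma CB_symmetric : symmetric (CB V).
Proof. by move=> s t; rewrite /CB /tC /tB !symm_symmetric. Qed.

Lemma FD_symmetric : symmetric (FD V).
Proof. by move=> s t; rewrite /FD /tF /tD !symm_symmetric. Qed.

Lemma JL_symmetric : symmetric (JL V).
Proof. by move=> s t; rewrite /JL /tJ /tL !symm_symmetric. Qed.

Lemma JCC_symmetric : symmetric (JCC V).
Proof. by move=> s t; rewrite /JCC /tJ !symm_symmetric. Qed.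

Lemma JKAD_symmetric : symmetric (JKAD V).
Proof. by move=> s t; rewrite /JKAD /tJ /tK !symm_symmetric. Qed.

End Tensors.

(** * The polynomial identities for a pair of quadratic forms *)

Section Pencil.
Variable R : comNzRingType.
Implicit Types (u : 'rV[R]_3) (A B E G : 'M[R]_3).

(* Matrices, rows and traces as plain functions of concrete indices: with these
   the identities below unfold to polynomials without a long chain of rewritings. *)
Let fsum (f : 'I_3 -> R) := f i0 + f i1 + f i2.
Let fmul (A B : 'I_3 -> 'I_3 -> R) a c := fsum (fun b => A a b * B b c).
Let frow (u : 'I_3 -> R) (B : 'I_3 -> 'I_3 -> R) c := fsum (fun b => u b * B b c).
Let ftr (A B : 'I_3 -> 'I_3 -> R) := fsum (fun a => fsum (fun b => A a b * B b a)).
Let fcontr (V : 'I_3 -> 'I_3 -> 'I_3 -> R) (u : 'I_3 -> R) b c :=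
  fsum (fun a => u a * V a b c).
Let fsym (f00 f01 f02 f11 f12 f22 : R) (a b : 'I_3) :=
  match nat_of_ord a, nat_of_ord b with
  | 0, 0 => f00 | 0, 1 | 1, 0 => f01 | 0, 2 | 2, 0 => f02
  | 1, 1 => f11 | 1, 2 | 2, 1 => f12 | _, _ => f22
  end.
Let fpencil (E G : 'I_3 -> 'I_3 -> R) (a b c : 'I_3) :=
  match nat_of_ord c with
  | 0 => E a i1 * G i2 b + E b i1 * G i2 a - E a i2 * G i1 b - E b i2 * G i1 a
  | 1 => E a i2 * G i0 b + E b i2 * G i0 a - E a i0 * G i2 b - E b i0 * G i2 a
  | _ => E a i0 * G i1 b + E b i0 * G i1 a - E a i1 * G i0 b - E b i1 * G i0 a
  end.

Let mulE A B : A *m B = fmul A B :> ('I_3 -> 'I_3 -> R).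
Proof. by apply/funext => a; apply/funext => c; rewrite mxE sum3. Qed.

Let rowE u B : (u *m B) 0 = frow (u 0) B.
Proof. by apply/funext => c; rewrite mxE sum3. Qed.

Let trE A B : \tr (A *m B) = ftr A B.
Proof. by rewrite /mxtrace sum3 !mxE !sum3. Qed.

Let contrE V u : contr V u = fcontr V (u 0) :> ('I_3 -> 'I_3 -> R).
Proof. by apply/funext => b; apply/funext => c; rewrite mxE sum3. Qed.

Let contr_e0 V : contr V (delta_mx 0 i0) = V i0 :> ('I_3 -> 'I_3 -> R).
Proof.
apply/funext => b; apply/funext => c.
by rewrite mxE sum3 !mxE /= !mul0r mul1r !addr0.
Qed.

Let row_e0 A : ((delta_mx 0 i0 : 'rV_3) *m A) 0 = A i0.
Proof. by apply/funext => c; rewrite mxE sum3 !mxE /= !mul0r mul1r !addr0. Qed.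

Let pencilE E G : pencil E G = fpencil E G.
Proof.
apply/funext => a; apply/funext => b; apply/funext.
by elim/ord3_ind; rewrite /pencil /fpencil sum3 !sum3 /=; ring.
Qed.

Let symE E : E^T = E ->
  fun_of_matrix E = fsym (E i0 i0) (E i0 i1) (E i0 i2) (E i1 i1) (E i1 i2) (E i2 i2).
Proof.
move=> sE; apply/funext; elim/ord3_ind; apply/funext; elim/ord3_ind => //=;
  by rewrite -[in LHS]sE mxE.
Qed.

(** At the covector (1, 0, 0) the polynomials are bihomogeneous in the components
    of E and G, with fewer than two thousand monomials, and the identities between
    them hold identically. *)
Lemma pencil_forms_e0 E G : E^T = E -> G^T = G ->
  let N := contr (pencil E G) in let x : 'rV_3 := delta_mx 0 i0 in
  [/\ formC N x - 2 * formB N x = 0, formF N x - 2 * formD N x = 0,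
      formJ N x - 2 * formL N x = 0,
      3 * formJ N x - 2 * formC N x ^+ 2 = 0 &
      formJ N x - 4 * formK N x + 4 * (formA N x * formD N x) = 0].
Proof.
move=> sE sG N x.
rewrite /formA /formB /formC /formD /formF /formJ /formK /formL !trE {}/N {}/x.
rewrite !(contr_e0, row_e0, mulE, rowE, contrE) pencilE (symE sE) (symE sG).
move: (E i0 i0) (E i0 i1) (E i0 i2) (E i1 i1) (E i1 i2) (E i2 i2) => a b c d e f.
move: (G i0 i0) (G i0 i1) (G i0 i2) (G i1 i1) (G i1 i2) (G i2 i2) => a' b' c' d' e' f'.
clear.
cbv beta delta [ftr fmul frow fcontr fpencil fsum fsym nat_of_ord] iota.
by split; ring.
Qed.
End Pencil.

Section Covariance.
Variable R : comNzRingType.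
Implicit Types (u x : 'rV[R]_3) (A B E G P Q : 'M[R]_3).

Lemma contr_scale (V : 'I_3 -> 'I_3 -> 'I_3 -> R) k u :
  contr V (k *: u) = k *: contr V u.
Proof.
apply/matrixP => b c; rewrite !mxE mulr_sumr.
by apply: eq_bigr => a _; rewrite mxE mulrA.
Qed.

(** Under N(u) = k P N'(u P) Q with Q inverse to P, the row w is multiplied by k and
    by Q on the right, and so on for the rows built from it; every trace is thus
    multiplied by k to the degree of the tensor. *)
Lemma forms_transform (N N' : 'rV[R]_3 -> 'M[R]_3) k P Q :
  Q *m P = 1%:M -> (forall a u, N' (a *: u) = a *: N' u) ->
  (forall u, N u = k *: (P *m N' (u *m P) *m Q)) ->
  forall x, let y := x *m P in
  [/\ formA N x = k ^+ 2 * formA N' y, formB N x = k ^+ 3 * formB N' y,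
      formC N x = k ^+ 3 * formC N' y & formD N x = k ^+ 4 * formD N' y] /\
  [/\ formF N x = k ^+ 4 * formF N' y, formJ N x = k ^+ 6 * formJ N' y,
      formK N x = k ^+ 6 * formK N' y & formL N x = k ^+ 6 * formL N' y].
Proof.
move=> QP N'Z NE x y.
have NP u v a : v *m P = a *: u -> N v = (k * a) *: (P *m N' u *m Q).
  by move=> vE; rewrite NE vE N'Z -scalemxAr -scalemxAl scalerA.
have rowN u v a : v *m P = a *: u -> forall (w z : 'rV_3) b, w *m P = b *: z ->
    (w *m N v) *m P = (k * (a * b)) *: (z *m N' u).
  move=> vE w z b wE; rewrite (NP _ _ _ vE) -scalemxAr -scalemxAl !mulmxA wE.
  by rewrite -(mulmxA _ Q) QP mulmx1 -scalemxAl scalerA mulrA.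
have conjM A B a b :
    (a *: (P *m A *m Q)) *m (b *: (P *m B *m Q)) = (a * b) *: (P *m (A *m B) *m Q).
  by rewrite -scalemxAl -scalemxAr scalerA !mulmxA -(mulmxA _ Q) QP mulmx1.
have trC A a : \tr (a *: (P *m A *m Q)) = a * \tr A.
  by rewrite mxtraceZ mxtrace_mulC mulmxA QP mul1mx.
have yE : x *m P = 1 *: y by rewrite scale1r.
have wE := rowN _ _ _ yE _ _ _ yE.
have nwE := rowN _ _ _ wE _ _ _ wE.
have wnE := rowN _ _ _ yE _ _ _ wE.
have jE := rowN _ _ _ yE _ _ _ nwE.
rewrite /formA /formB /formC /formD /formF /formJ /formK /formL.
rewrite (NP _ _ _ jE) (NP _ _ _ wnE) (NP _ _ _ nwE) (NP _ _ _ wE) (NP _ _ _ yE).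
by rewrite !conjM !trC; split; split; ring.
Qed.

(** The matrix of the cross product with u. *)
Definition cross u : 'M[R]_3 := \matrix_(m, c) \sum_j u 0 j * levi R m c j.

Lemma contr_pencil E G u : G^T = G ->
  contr (pencil E G) u = G *m cross (u *m E) - E *m cross (u *m G).
Proof.
move=> sG; have GE a b : G a b = G b a by rewrite -[in LHS]sG mxE.
apply/matrixP => b c; rewrite mxE [RHS]mxE [X in _ + X]mxE.
rewrite !sum3 !mxE !sum3 !mxE !sum3 !mxE !sum3.
rewrite /pencil !sum3 (GE i0 b) (GE i1 b) (GE i2 b).
rewrite (GE i1 i0) (GE i2 i0) (GE i2 i1).
by elim/ord3_ind: c => /=; ring.
Qed.

(** The factor k is det P: the volume form is multiplied by it. *)
Lemma cross_transform P :
  exists k, forall u, P^T *m cross (u *m P^T) *m P = k *: cross u.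
Proof.
exists (P i0 i0 * (P i1 i1 * P i2 i2 - P i1 i2 * P i2 i1)
      - P i0 i1 * (P i1 i0 * P i2 i2 - P i1 i2 * P i2 i0)
      + P i0 i2 * (P i1 i0 * P i2 i1 - P i1 i1 * P i2 i0)) => u.
apply/matrixP; elim/ord3_ind; elim/ord3_ind;
  by rewrite !mxE !sum3 !mxE !sum3 !mxE !sum3 !mxE /= !sum3 !mxE; ring.
Qed.

(** Equivariance of the pencil under a linear change of frame; the factor k comes
    from eps being a tensor density rather than a tensor. *)
Lemma contr_pencil_transform E G P Q : Q *m P = 1%:M -> G^T = G ->
  exists k, forall u, contr (pencil (P *m E *m P^T) (P *m G *m P^T)) u
    = k *: (P *m contr (pencil E G) (u *m P) *m Q).
Proof.
move=> QP sG; have [k kP] := cross_transform P; exists k => u.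
have {kP} crossP v : P^T *m cross (v *m P^T) = k *: (cross v *m Q).
  rewrite scalemxAl -kP -mulmxA; have /mulmx1C -> := QP.
  by rewrite mulmx1.
rewrite !contr_pencil//; last by rewrite !trmx_mul trmxK sG mulmxA.
by rewrite !mulmxA -!(mulmxA _ P^T) !crossP mulmxBr mulmxBl scalerBr
  -!scalemxAr !mulmxA.
Qed.

End Covariance.

Section PencilVanish.

(** A nonzero covector is the first member of some basis.  The row echelon
    decomposition of x provides the basis up to a scalar. *)
Lemma row_complete (F : fieldType) (x : 'rV[F]_3) :
  x != 0 -> exists P Q : 'M[F]_3, Q *m P = 1%:M /\ x *m P = delta_mx 0 i0.
Proof.
move=> x0; have := mulmx_ebase x.
have -> : \rank x = 1%N by rewrite rank_rV x0.
have := col_ebase_unit x; rewrite [col_ebase x]mx11_scalar unitmxE det_scalar1 unitfE.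
set a := col_ebase x 0 0; set Q := row_ebase x => a0 xE.
have Qu : Q \in unitmx by exact: row_ebase_unit.
(* a is the invertible 1 x 1 factor of the echelon decomposition of x. *)
exists (a^-1 *: invmx Q), (a *: Q); split.
  by rewrite -scalemxAl -scalemxAr scalerA mulfV// scale1r mulmxV.
rewrite -xE mul_scalar_mx -scalemxAr -!scalemxAl scalerA mulVf// scale1r mulmxK//.
by apply/matrixP => i j; rewrite !mxE ord1; case: j => -[|[|[|]]].
Qed.

(** A frame whose first covector is x reduces the identities at x to those at the
    first basis covector, for the transported forms E' and G'. *)
Lemma pencil_forms (F : fieldType) (E G : 'M[F]_3) x : E^T = E -> G^T = G ->
  let N := contr (pencil E G) in
  [/\ formC N x - 2 * formB N x = 0, formF N x - 2 * formD N x = 0,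
      formJ N x - 2 * formL N x = 0,
      3 * formJ N x - 2 * formC N x ^+ 2 = 0 &
      formJ N x - 4 * formK N x + 4 * (formA N x * formD N x) = 0].
Proof.
move=> sE sG N; have [->|/row_complete[P [Q [QP xP]]]] := eqVneq x 0.
  have N0 : N 0 = 0 by rewrite -[0 in LHS](scale0r 0) /N contr_scale scale0r.
  rewrite /formA /formB /formC /formD /formF /formJ /formK /formL.
  rewrite !(N0, mul0mx, mulmx0, linear0).
  by split; ring.
have PQ : P *m Q = 1%:M by apply: mulmx1C.
pose E' := Q *m E *m Q^T; pose G' := Q *m G *m Q^T.
have sE' : E'^T = E' by rewrite /E' !trmx_mul trmxK sE mulmxA.
have sG' : G'^T = G' by rewrite /G' !trmx_mul trmxK sG mulmxA.
have cancelP A : P *m (Q *m A *m Q^T) *m P^T = A.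
  by rewrite !mulmxA PQ mul1mx -mulmxA -trmx_mul PQ trmx1 mulmx1.
have [k Nk] := contr_pencil_transform E' QP sG'.
have {}Nk u : N u = k *: (P *m contr (pencil E' G') (u *m P) *m Q).
  by rewrite -Nk !cancelP.
have [] := forms_transform QP (contr_scale _) Nk x.
rewrite xP => -[-> -> -> ->] [-> -> -> ->].
have [CB0 FD0 JL0 JCC0 JKAD0] := pencil_forms_e0 sE' sG'.
split.
- by rewrite mulrCA -mulrBr CB0 mulr0.
- by rewrite mulrCA -mulrBr FD0 mulr0.
- by rewrite mulrCA -mulrBr JL0 mulr0.
- by rewrite -[RHS](mulr0 (k ^+ 6)) -JCC0; ring.
- by rewrite -[RHS](mulr0 (k ^+ 6)) -JKAD0; ring.
Qed.

Lemma pencil_vanish (R : realType) (E G : 'M[R]_3) : E^T = E -> G^T = G ->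
  let V : comp3 R := pencil E G in
  [/\ forall t, CB V t = 0, forall t, FD V t = 0, forall t, JL V t = 0,
      forall t, JCC V t = 0 & forall t, JKAD V t = 0].
Proof.
move=> sE sG V; split.
- apply: symmetric_eq0 (@CB_symmetric _ V) _ => x.
  by rewrite hat_CB; have [] := pencil_forms x sE sG.
- apply: symmetric_eq0 (@FD_symmetric _ V) _ => x.
  by rewrite hat_FD; have [] := pencil_forms x sE sG.
- apply: symmetric_eq0 (@JL_symmetric _ V) _ => x.
  by rewrite hat_JL; have [] := pencil_forms x sE sG.
- apply: symmetric_eq0 (@JCC_symmetric _ V) _ => x.
  by rewrite hat_JCC; have [] := pencil_forms x sE sG.
- apply: symmetric_eq0 (@JKAD_symmetric _ V) _ => x.
  by rewrite hat_JKAD; have [] := pencil_forms x sE sG.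
Qed.
End PencilVanish.

(** * Calculus: commuting derivatives and smooth functions *)

Section MixedDerivatives.
Variables (R : realType) (U : normedModType R).
Implicit Types (f : U -> R) (u v x : U).

Lemma is_derive_line f (df : R) x u (s : R) : is_derive (x + s *: u) u f df ->
  is_derive s 1 (fun r : R => f (x + r *: u)) df.
Proof.
have quotE : (fun h : R => h^-1 *: (((fun r => f (x + r *: u)) \o shift s) (h *: 1) -
      f (x + s *: u))) =
    (fun h => h^-1 *: ((f \o shift (x + s *: u)) (h *: u) - f (x + s *: u))).
  apply/funext => h /=; congr (_ *: (f _ - _)).
  by rewrite [h%:A]mulr1 scalerDl addrCA.
by move=> [dfx dfE]; apply: DeriveDef; rewrite /derivable /derive /= quotE.
Qed.

Lemma mean_value (g dg : R -> R) (h : R) : 0 < h ->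
  (forall s, 0 <= s <= h -> is_derive s 1 g (dg s)) ->
  exists2 s, 0 <= s <= h & g h - g 0 = dg s * h.
Proof.
move=> h0 gd; have [s|/=|s] := @MVT R g dg 0 h h0.
- by rewrite in_itv /= => /andP[s0 sh]; apply: gd; rewrite !ltW.
- apply: derivable_within_continuous => s; rewrite in_itv /= => sI.
  by have [] := gd s sI.
- rewrite in_itv /= subr0 => /andP[s0 sh] gE; exists s => //.
  by rewrite !ltW.
Qed.

(** Two uses of the mean value theorem: along u for the increment in the direction
    v, then along v for the derivative in the direction u. *)
Lemma mixed_difference f fu fuv u v x (h : R) : 0 < h ->
  (forall s t, 0 <= s <= h -> 0 <= t <= h -> let y := x + s *: u + t *: v in
     is_derive y u f (fu y) /\ is_derive y v fu (fuv y)) ->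
  exists s t : R, [/\ 0 <= s <= h, 0 <= t <= h &
    f (x + h *: u + h *: v) - f (x + h *: u) - f (x + h *: v) + f x
    = fuv (x + s *: u + t *: v) * h ^+ 2].
Proof.
move=> h0 df.
have hh : 0 <= h <= h by rewrite lexx ltW.
have oo : 0 <= (0 : R) <= h by rewrite lexx ltW.
pose g (s : R) : R := f (x + h *: v + s *: u) - f (x + s *: u).
pose dg (s : R) : R := fu (x + h *: v + s *: u) - fu (x + s *: u).
have gd (s : R) : 0 <= s <= h -> is_derive s 1 g (dg s).
  move=> sh; apply: is_deriveB; apply: is_derive_line.
    have [+ _] := df s h sh hh; rewrite addrAC; exact.
  have [+ _] := df s 0 sh oo; rewrite scale0r addr0; exact.
have [s sh gs] := mean_value h0 gd.
pose k (t : R) : R := fu (x + s *: u + t *: v).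
have kd (t : R) : 0 <= t <= h -> is_derive t 1 k (fuv (x + s *: u + t *: v)).
  by move=> th; apply: is_derive_line; have [] := df s t sh th.
have [t th kt] := mean_value h0 kd.
exists s, t; split => //.
have dgk : dg s = k h - k 0 by rewrite /dg /k addrAC scale0r addr0.
move: gs; rewrite dgk kt /g !scale0r !addr0 [x + h *: v + h *: u]addrAC => gE.
by rewrite expr2 mulrA -gE; ring.
Qed.

(** Schwarz: both iterated derivatives are limits of the same second difference.
    The derivatives are functions given beforehand, only related to f by is_derive,
    so that terms containing iterated limits are never compared. *)
Lemma derive_comm f fu fv fuv fvu u v (V : set U) x : open V -> V x ->
  (forall y, V y -> [/\ is_derive y u f (fu y), is_derive y v f (fv y),
     is_derive y v fu (fuv y) & is_derive y u fv (fvu y)]) ->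
  {for x, continuous fuv} -> {for x, continuous fvu} -> fuv x = fvu x.
Proof.
move=> oV Vx df cuv cvu; apply/eqP; rewrite -subr_eq0 -normr_eq0.
apply/eqP/le_anti; rewrite normr_ge0 andbT; apply/ler_addgt0Pr => e e0.
have e20 : 0 < e / 2 by rewrite divr_gt0.
have := open_nbhs_nbhs (conj oV Vx).
move/cvgrPdist_lt: cuv => /(_ _ e20); move/cvgrPdist_lt: cvu => /(_ _ e20).
move=> /nbhs_ballP[d1 /= d10 B1] /nbhs_ballP[d2 /= d20 B2] /nbhs_ballP[d3 /= d30 B3].
pose d := Num.min d1 (Num.min d2 d3).
have d0 : 0 < d by rewrite !lt_min d10 d20.
(* With this M, a step d / M keeps the whole parallelogram inside the ball. *)
pose M := `|u| + `|v| + 1.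
have M0 : 0 < M by rewrite ltr_wpDl// addr_ge0.
pose h := d / M.
have h0 : 0 < h by rewrite divr_gt0.
have inball (s t : R) : 0 <= s <= h -> 0 <= t <= h -> ball x d (x + s *: u + t *: v).
  move=> /andP[s0 sh] /andP[t0 th].
  rewrite -ball_normE /ball_ /= -addrA opprD addNKr normrN.
  apply: (le_lt_trans (ler_normD _ _)); rewrite !normrZ !ger0_norm//.
  apply: (@le_lt_trans _ _ (h * (`|u| + `|v|))).
    by rewrite mulrDr lerD// ler_wpM2r.
  rewrite -[ltRHS](@divfK _ M) ?gt_eqF// ltr_pM2l//.
  by rewrite /M ltrDl.
have le1 : d <= d1 by rewrite /d ge_min lexx.
have le2 : d <= d2 by rewrite /d !ge_min lexx orbT.
have le3 : d <= d3 by rewrite /d !ge_min lexx !orbT.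
have [|s [t [sh th E1]]] := @mixed_difference f fu fuv u v x h h0.
  by move=> s t sh th y; have /B3/df[] := le_ball le3 (inball s t sh th).
have [{s t sh th E1}|t' [s' [th' sh' E2]]] := @mixed_difference f fv fvu v u x h h0.
  move=> t s th sh /=; rewrite [x + _ + _]addrAC.
  by have /B3/df[] := le_ball le3 (inball s t sh th).
have same : fuv (x + s *: u + t *: v) = fvu (x + s' *: u + t' *: v).
  have h2 : h ^+ 2 != 0 by rewrite expf_neq0// gt_eqF.
  rewrite -[LHS](mulfK h2) -[RHS](mulfK h2) -E1 [in RHS]addrAC -E2.
  by rewrite [x + h *: v + h *: u]addrAC [X in (X + _) / _ = _]addrAC.
have D1 := B2 _ (le_ball le2 (inball s t sh th)).
have D2 := B1 _ (le_ball le1 (inball s' t' sh' th')).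
rewrite add0r [e]splitr.
have -> : fuv x - fvu x = (fuv x - fuv (x + s *: u + t *: v))
    - (fvu x - fvu (x + s' *: u + t' *: v)).
  by rewrite same opprB addrA subrK.
by apply: (le_trans (ler_normB _ _)); rewrite ltW// ltrD.
Qed.
End MixedDerivatives.

Section SmoothFunctions.
Variable R : realType.
Implicit Types (V : set 'rV[R]_3) (f g : 'rV[R]_3 -> R) (k : nat) (a : 'I_3).

Lemma partialE a f (df : R) x : is_derive x (delta_mx 0 a) f df -> partial a f x = df.
Proof. by case. Qed.

Lemma near_eq_on V f g x : open V -> (forall y, V y -> f y = g y) -> V x ->
  \forall y \near x, f y = g y.
Proof.
move=> oV fg Vx; have nV : nbhs x V by exact: open_nbhs_nbhs.
by apply: filterS nV => y /fg.
Qed.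

(** Fields are total functions that only matter on the open image of a chart, so
    every operation has to be local. *)
Lemma partial_congr V f g a x : open V -> (forall y, V y -> f y = g y) -> V x ->
  partial a f x = partial a g x.
Proof.
move=> oV fg Vx; apply: near_eq_derive.
exact: near_eq_on oV fg Vx.
Qed.

Lemma Ck_congr V k f g : open V -> (forall x, V x -> f x = g x) ->
  Ck k V f -> Ck k V g.
Proof.
move=> oV; elim: k f g => [|k IHk] f g fg [fc fk]; split => //.
- move=> x Vx; rewrite /prop_for /continuous_at -(fg x Vx).
  exact: cvg_trans (near_eq_cvg (near_eq_on oV fg Vx)) (fc x Vx).
- move=> x Vx; rewrite /prop_for /continuous_at -(fg x Vx).
  exact: cvg_trans (near_eq_cvg (near_eq_on oV fg Vx)) (fc x Vx).
- move=> a; have [fd fak] := fk a; split => [x Vx|].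
    apply: near_eq_derivable (fd x Vx).
    exact: near_eq_on oV fg Vx.
  by apply: (IHk _ _ _ fak) => x Vx; apply: partial_congr Vx.
Qed.

Lemma smooth_continuous V f x : smooth V f -> V x -> {for x, continuous f}.
Proof. by move=> /(_ 0%N)[+ _]; apply. Qed.

Lemma smooth_partial V f a : smooth V f -> smooth V (partial a f).
Proof. by move=> fs k; have [_ /(_ a)[]] := fs k.+1. Qed.

Lemma smooth_derive V f x a : smooth V f -> V x ->
  is_derive x (delta_mx 0 a) f (partial a f x).
Proof.
by move=> /(_ 1%N)[_ /(_ a)[fd _]] Vx; apply: DeriveDef => //; exact: fd.
Qed.

Lemma partial_comm V f x a b : open V -> smooth V f -> V x ->
  partial a (partial b f) x = partial b (partial a f) x.
Proof.
move=> oV fs Vx; have da := smooth_partial a fs; have db := smooth_partial b fs.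
apply: (@derive_comm R _ f (partial b f) (partial a f) (partial a (partial b f))
  (partial b (partial a f)) (delta_mx 0 b) (delta_mx 0 a) V) => //.
- move=> y Vy; have sd f' c (f's : smooth V f') := smooth_derive c f's Vy.
  by split; [exact: sd b fs|exact: sd a fs|exact: sd a db|exact: sd b da].
- exact/smooth_continuous/Vx/smooth_partial.
- exact/smooth_continuous/Vx/smooth_partial.
Qed.

Lemma CkW V k f : Ck k.+1 V f -> Ck k V f.
Proof.
elim: k f => [|k IHk] f [fc fk]; split => // a; have [fd fak] := fk a.
by split => //; exact: IHk.
Qed.

Lemma CkD V k f g : open V -> Ck k V f -> Ck k V g -> Ck k V (fun x => f x + g x).
Proof.
move=> oV; elim: k f g => [|k IHk] f g [fc fk] [gc gk]; split.
- by move=> x Vx; exact: (cvgD (fc x Vx) (gc x Vx)).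
- by [].
- by move=> x Vx; exact: (cvgD (fc x Vx) (gc x Vx)).
move=> a; have [fd fak] := fk a; have [gd gak] := gk a; split.
  by move=> x Vx; apply: derivableD; [exact: fd|exact: gd].
apply: Ck_congr oV _ (IHk _ _ fak gak) => x Vx.
by apply/esym/partialE/is_deriveD; apply: DeriveDef => //; [exact: fd|exact: gd].
Qed.

Lemma CkM V k f g : open V -> Ck k V f -> Ck k V g -> Ck k V (fun x => f x * g x).
Proof.
move=> oV; elim: k f g => [|k IHk] f g Cf Cg; have [fc fk] := Cf; have [gc gk] := Cg; split.
- by move=> x Vx; exact: (cvgM (fc x Vx) (gc x Vx)).
- by [].
- by move=> x Vx; exact: (cvgM (fc x Vx) (gc x Vx)).
move=> a; have [fd fak] := fk a; have [gd gak] := gk a; split.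
  by move=> x Vx; apply: derivableM; [exact: fd|exact: gd].
apply: Ck_congr oV _ (CkD oV (IHk _ _ (CkW Cf) gak) (IHk _ _ (CkW Cg) fak)) => x Vx.
by apply/esym/partialE/is_deriveM; apply: DeriveDef => //; [exact: fd|exact: gd].
Qed.

Lemma partial_cst (c : R) a : partial a (fun=> c) = fun=> 0.
Proof. by apply/funext => x; exact: derive_cst. Qed.

Lemma smooth_cst V (c : R) : smooth V (fun=> c).
Proof.
have cc (d : R) x : {for x, continuous (fun _ : 'rV[R]_3 => d)} by exact: cst_continuous.
move=> k; elim: k c => [|k IHk] c.
  by split=> [x _|]; [exact: cc|].
split=> [x _|a]; first exact: cc.
split=> [x _|]; first exact: (@derivable_cst _ _ _ c x).
by rewrite partial_cst; exact: IHk.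
Qed.

Lemma smoothD V f g : open V -> smooth V f -> smooth V g -> smooth V (fun x => f x + g x).
Proof. by move=> oV fs gs k; exact: CkD. Qed.

Lemma smoothM V f g : open V -> smooth V f -> smooth V g -> smooth V (fun x => f x * g x).
Proof. by move=> oV fs gs k; exact: CkM. Qed.

Lemma smooth_sum V (F : 'I_3 -> 'rV[R]_3 -> R) : open V ->
  (forall d, smooth V (F d)) -> smooth V (fun x => \sum_d F d x).
Proof.
move=> oV Fs; have -> : (fun x => \sum_d F d x) = fun x => F i0 x + F i1 x + F i2 x.
  by apply/funext => x; rewrite sum3.
by apply: smoothD => //; exact: smoothD.
Qed.

Lemma partialD V f g x a : smooth V f -> smooth V g -> V x ->
  partial a (fun y => f y + g y) x = partial a f x + partial a g x.
Proof. by move=> fs gs Vx; apply/partialE/is_deriveD; exact: smooth_derive Vx. Qed.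

Lemma partialM V f g x a : smooth V f -> smooth V g -> V x ->
  partial a (fun y => f y * g y) x = partial a f x * g x + f x * partial a g x.
Proof.
move=> fs gs Vx; rewrite addrC [_ * g x]mulrC.
by apply/partialE/is_deriveM; exact: smooth_derive Vx.
Qed.

Lemma partial_sum V (F : 'I_3 -> 'rV[R]_3 -> R) x a : open V ->
  (forall d, smooth V (F d)) -> V x ->
  partial a (fun y => \sum_d F d y) x = \sum_d partial a (F d) x.
Proof.
move=> oV Fs Vx; have -> : (fun x => \sum_d F d x) = fun x => F i0 x + F i1 x + F i2 x.
  by apply/funext => y; rewrite sum3.
by rewrite sum3 !(@partialD V)//; exact: smoothD.
Qed.

Lemma is_derive_coord (x v : 'rV[R]_3) b :
  is_derive x v (fun y : 'rV[R]_3 => y 0 b) (v 0 b).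
Proof.
have quot : (fun h : R => h^-1 *: (((fun y : 'rV[R]_3 => y 0 b) \o shift x) (h *: v) - x 0 b))
    @ 0^' --> v 0 b.
  apply: (@cvg_trans _ ((fun=> v 0 b) @ 0^')); last exact: cvg_cst.
  apply: near_eq_cvg; near=> h; rewrite /= !mxE addrK /GRing.scale /= mulKf//.
  by near: h; exact: nbhs_dnbhs_neq.
apply: DeriveDef; first by apply/cvg_ex; exists (v 0 b).
by apply: cvg_lim quot => //; exact: Rhausdorff.
Unshelve. all: by end_near. Qed.

Lemma partial_coord a b :
  partial a (fun x : 'rV[R]_3 => x 0 b) = fun=> (b == a)%:R.
Proof.
by apply/funext => x; rewrite (partialE (is_derive_coord _ _ _)) !mxE eqxx.
Qed.

Lemma smooth_coord V b : smooth V (fun x : 'rV[R]_3 => x 0 b).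
Proof.
have cc x : {for x, continuous (fun y : 'rV[R]_3 => y 0 b)} by exact: coord_continuous.
move=> [|k]; first by split=> [x _|]; [exact: cc|].
split=> [x _|a]; first exact: cc.
split=> [x _|]; first by have [] := is_derive_coord x (delta_mx 0 a) b.
by rewrite partial_coord; exact: smooth_cst.
Qed.

End SmoothFunctions.

(** * Christoffel symbols and components of the curvature *)

Section Christoffel.
Variables (R : realType) (M : manifold3 R) (D : connection M) (i : chart M).
Implicit Types (X Y : 'rV[R]_3 -> 'rV[R]_3) (x : 'rV[R]_3) (a b c d : 'I_3).

Definition coord_field d : 'rV[R]_3 -> 'rV[R]_3 := fun=> delta_mx 0 d.

(** christoffel a d c is the symbol Gamma_{ad}^c, from nabla_a e_d. *)
Definition christoffel a d c : 'rV[R]_3 -> R := fun x => D i (coord_field d) x a c.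

Lemma img_open : open (img i).
Proof. exact: phi_open. Qed.

Lemma coord_field_smooth V d : smooth_mx V (coord_field d).
Proof. by move=> k l; exact: smooth_cst. Qed.

Lemma christoffel_smooth a d c : smooth (img i) (christoffel a d c).
Proof.
have ss : img i `<=` img i by [].
have := @nabla_smooth _ _ D i _ (coord_field d) img_open ss (@coord_field_smooth _ d).
by move=> /(_ a c).
Qed.

(** Leibniz rule applied to the decomposition of X in the coordinate frame. *)
Lemma nablaE X x a b : smooth_mx (img i) X -> img i x ->
  D i X x a b
  = partial a (fun y => X y 0 b) x + \sum_d X x 0 d * christoffel a d b x.
Proof.
move=> Xs ix; have oi := img_open; have ss : img i `<=` img i by [].
pose Z d := fun y => X y 0 d *: coord_field d y.
have Zs d : smooth_mx (img i) (Z d).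
  move=> k l; rewrite ord1.
  have -> : (fun y => Z d y 0 l) = fun y => X y 0 d * (l == d)%:R.
    by apply/funext => y; rewrite !mxE eqxx.
  by apply: smoothM => //; exact: smooth_cst.
have ZDs (Z1 Z2 : 'rV[R]_3 -> 'rV[R]_3) : smooth_mx (img i) Z1 -> smooth_mx (img i) Z2 ->
    smooth_mx (img i) (Z1 \+ Z2).
  move=> Z1s Z2s k l; have -> : (fun y => (Z1 \+ Z2) y k l)
      = fun y => Z1 y k l + Z2 y k l by apply/funext => y; rewrite !mxE.
  exact: smoothD.
pose p d := partial a (fun y => X y 0 d) x.
pose q d := X x 0 d * christoffel a d b x.
have DZ d : D i (Z d) x a b = p d * (b == d)%:R + q d.
  rewrite (nabla_leibniz D oi ss (Xs 0 d) (@coord_field_smooth _ d) ix) !mxE.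
  by rewrite big_ord1 !mxE eqxx.
have XE : X = (Z i0 \+ Z i1) \+ Z i2.
  apply/funext => y; apply/rowP; elim/ord3_ind;
    by rewrite !mxE /= ?mulr1 ?mulr0 ?addr0 ?add0r.
rewrite [in LHS]XE (nabla_add D oi ss (ZDs _ _ (Zs i0) (Zs i1)) (Zs i2) ix).
rewrite (nabla_add D oi ss (Zs i0) (Zs i1) ix) mxE [X in X + _]mxE !DZ.
rewrite -/(p b) -[\sum_d _]/(\sum_d q d) sum3.
move: p q {DZ} => p q; elim/ord3_ind: b => /=; ring.
Qed.

Lemma cov_coord_field a d x : cov D i (coord_field a) (coord_field d) x = row a (D i (coord_field d) x).
Proof. by rewrite /cov /coord_field -rowE. Qed.

Lemma cov_coord_fieldE a d x c : cov D i (coord_field a) (coord_field d) x 0 c = christoffel a d c x.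
Proof. by rewrite cov_coord_field mxE. Qed.

Lemma lie_bracket_coord_field a b : lie_bracket (coord_field a) (coord_field b) = fun=> 0.
Proof.
apply/funext => x; apply/rowP => c; rewrite [RHS]mxE mxE big1// => d _.
by rewrite /coord_field !partial_cst !mulr0 subrr.
Qed.

Lemma christoffel_sym : torsion_free D ->
  forall a d c x, img i x -> christoffel a d c x = christoffel d a c x.
Proof.
move=> tf a d c x ix.
have := tf i _ _ (@coord_field_smooth _ a) (@coord_field_smooth _ d) x ix.
rewrite lie_bracket_coord_field => /rowP/(_ c); rewrite mxE [X in _ + X]mxE !cov_coord_fieldE mxE.
by move/eqP; rewrite subr_eq0 => /eqP.
Qed.

End Christoffel.

Section CurvatureComponents.
Variable R : realType.

(** The component R_{ab}^c_d, where G a d c is Gamma_{ad}^c and dG b a d c is its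
    derivative in the direction b, both at one point. *)
Definition riemann (dG : 'I_3 -> comp3 R) (G : comp3 R) : comp4 R := fun a b c d =>
  dG a b d c - dG b a d c + \sum_m (G b d m * G a m c - G a d m * G b m c).

Definition gamma_at (M : manifold3 R) (D : connection M) (i : chart M) x : comp3 R :=
  fun a d c => christoffel D i a d c x.

Definition dgamma_at (M : manifold3 R) (D : connection M) (i : chart M) x :
    'I_3 -> comp3 R :=
  fun a b d c => partial a (christoffel D i b d c) x.

Lemma sum_coord_field (F : 'I_3 -> R) d x : \sum_e F e * (@coord_field R d) x 0 e = F d.
Proof.
rewrite (bigD1 d)//= mxE !eqxx mulr1 big1 ?addr0// => e /negPf ne.
by rewrite mxE ne mulr0.
Qed.

(** The defining identity of the curvature is evaluated on coordinate vector
    fields, whose brackets vanish. *)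
Lemma curvature_components (M : manifold3 R) (D : connection M) Rm i x :
  is_curvature D Rm -> img i x -> Rm i x = riemann (dgamma_at D i x) (gamma_at D i x).
Proof.
move=> DRm ix; apply/funext => a; apply/funext => b; apply/funext => c.
apply/funext => d.
have fs e := @coord_field_smooth R (img i) e.
have := DRm i _ _ _ (fs a) (fs b) (fs d) x ix c.
have cs e f : smooth_mx (img i) (cov D i (@coord_field R e) (@coord_field R f)).
  move=> k l; rewrite ord1.
  have -> : (fun y => cov D i (@coord_field R e) (@coord_field R f) y 0 l) = christoffel D i e f l.
    by apply/funext => y; rewrite cov_coord_fieldE.
  exact: christoffel_smooth.
have covE e f g : cov D i (@coord_field R e) (cov D i (@coord_field R f) (@coord_field R g)) x 0 c
    = dgamma_at D i x e f g c + \sum_m gamma_at D i x f g m * gamma_at D i x e m c.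
  rewrite {1}/cov {1}/coord_field -rowE mxE nablaE// /dgamma_at; congr (_ + _).
    by congr partial; apply/funext => y; rewrite cov_coord_fieldE.
  by apply: eq_bigr => m _; rewrite cov_coord_fieldE.
rewrite lie_bracket_coord_field [cov D i (fun=> 0) _ x]mul0mx subr0.
rewrite mxE [X in _ + X]mxE !covE => RmE.
have -> : Rm i x a b c d = \sum_a' \sum_b' \sum_d'
   Rm i x a' b' c d' * @coord_field R a x 0 a' * @coord_field R b x 0 b' * @coord_field R d x 0 d'.
  under eq_bigr do under eq_bigr do rewrite sum_coord_field.
  under eq_bigr do rewrite sum_coord_field.
  by rewrite sum_coord_field.
by rewrite -RmE /riemann sumrB opprD addrACA.
Qed.

Lemma partial_christoffel_sym (M : manifold3 R) (D : connection M) i x :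
  torsion_free D -> img i x -> forall a b d c, dgamma_at D i x a b d c = dgamma_at D i x a d b c.
Proof.
move=> tf ix a b d c; rewrite /dgamma_at.
have e y : img i y -> christoffel D i b d c y = christoffel D i d b c y by exact: christoffel_sym.
exact: (@partial_congr _ (img i) _ _ a _ (@img_open _ _ i) e ix).
Qed.

Lemma christoffel_proj (M : manifold3 R) (D D' : connection M) : proj_equiv D D' ->
  exists u, is_oneform u /\ forall i x, img i x -> forall a d c,
    christoffel D' i a d c x
    = christoffel D i a d c x + u i x 0 a * (d == c)%:R + (a == c)%:R * u i x 0 d.
Proof.
case=> u [u1 uE]; exists u; split => // i x ix a d c.
rewrite /christoffel (uE i _ (@coord_field_smooth R _ d) x ix) /coord_field mxE /= [c == d]eq_sym.
congr (_ + _ + _ * _); rewrite (bigD1 d)//= mxE !eqxx mulr1 big1 ?addr0// => m /negPf md.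
by rewrite mxE md mulr0.
Qed.

(** Compatibility with g, evaluated on coordinate vector fields. *)
Lemma metric_derivative (M : manifold3 R) (D : connection M) g :
  metric_compatible D g -> forall i x, img i x -> forall a c d,
    partial a (fun y => g i y c d) x
    = \sum_m (christoffel D i a c m x * g i x m d + christoffel D i a d m x * g i x c m).
Proof.
move=> Dg i x ix a c d.
have := Dg i _ _ (@coord_field_smooth R _ c) (@coord_field_smooth R _ d) x ix a.
have e0 (G : 'M[R]_3) (v : 'rV[R]_3) e : inner G v (delta_mx 0 e) = \sum_m v 0 m * G m e.
  by rewrite /inner trmx_delta -colE mxE mxE.
have e1 (G : 'M[R]_3) (v : 'rV[R]_3) e : inner G (delta_mx 0 e) v = \sum_m v 0 m * G e m.
  rewrite /inner -rowE mxE; apply: eq_bigr => m _.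
  by rewrite !mxE mulrC.
have -> : (fun y => inner (g i y) (@coord_field R c y) (@coord_field R d y)) = fun y => g i y c d.
  apply/funext => y; rewrite e0 (bigD1 c)//= mxE !eqxx mul1r big1 ?addr0// => m /negPf mc.
  by rewrite mxE mc mul0r.
move=> ->; rewrite e0 e1 -big_split; apply: eq_bigr => m _.
by rewrite !mxE.
Qed.

End CurvatureComponents.

Section LeviCivitaCurvature.
Variables (R : realType) (M : manifold3 R) (D : connection M).
Variables (g : chart M -> 'rV[R]_3 -> 'M[R]_3) (i : chart M) (x : 'rV[R]_3).
Hypotheses (gM : is_metric g) (Dg : metric_compatible D g) (ix : img i x).
Let G := gamma_at D i x.
Let dG := dgamma_at D i x.

Let dg a c d := \sum_m (G a c m * g i x m d + G a d m * g i x c m).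

Lemma metric_second_derivative a b c d :
  partial b (partial a (fun y => g i y c d)) x
  = \sum_m (dG b a c m * g i x m d + G a c m * dg b m d
          + (dG b a d m * g i x c m + G a d m * dg b c m)).
Proof.
have oi := @img_open _ _ i; have [gs _ _ _] := gM.
have chs e f m := @christoffel_smooth _ _ D i e f m.
have gsm m n : smooth (img i) (fun y => g i y m n) := gs i m n.
have dgE e m n : partial e (fun y => g i y m n) x = dg e m n.
  by rewrite (metric_derivative Dg ix).
have dgf y (iy : img i y) := metric_derivative Dg iy a c d.
rewrite (partial_congr b oi dgf ix).
rewrite (partial_sum b oi) => [|m|//]; last by apply: smoothD => //; exact: smoothM.
apply: eq_bigr => m _.
rewrite (partialD b (V := img i)) ?(partialM b (V := img i)) ?dgE//; exact: smoothM.
Qed.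

(** The commutator of second derivatives annihilates the components of g; expressed
    by compatibility, it is the curvature acting on both indices of g. *)
Lemma riemann_skew a b c d :
  \sum_m riemann dG G a b m c * g i x m d
  + \sum_m riemann dG G a b m d * g i x c m = 0.
Proof.
have [gs _ _ _] := gM.
have := partial_comm a b (@img_open _ _ i) (gs i c d) ix.
rewrite !metric_second_derivative /dg /riemann !sum3 => /eqP; rewrite -subr_eq0 => /eqP <-.
(* Derivatives are replaced by variables first: the decision procedure would
   otherwise compare them by unfolding limits. *)
move: dG G (g i x) => dG' G' g'; ring.
Qed.

End LeviCivitaCurvature.

(** * Algebra of the curvature of a metrizable connection *)

Section CurvatureAlgebra.
Variable R : realType.
Implicit Types (a b c d : 'I_3) (Q : 'M[R]_3).

Lemma riemann_skew12 (dG : 'I_3 -> comp3 R) (G : comp3 R) a b c d :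
  riemann dG G b a c d = - riemann dG G a b c d.
Proof. by rewrite /riemann !sum3; ring. Qed.

(** First Bianchi identity: it only uses that the symbols are symmetric in their
    lower indices. *)
Lemma riemann_cyclic (dG : 'I_3 -> comp3 R) (G : comp3 R) :
  (forall a b c, G a b c = G b a c) -> (forall a b d c, dG a b d c = dG a d b c) ->
  forall a b c d,
    riemann dG G a b c d + riemann dG G b d c a + riemann dG G d a c b = 0.
Proof.
move=> Gs dGs a b c d; rewrite /riemann !sum3.
rewrite (dGs a d b) (dGs b d a) (dGs d b a) !(Gs d b) !(Gs d a) !(Gs b a).
by ring.
Qed.

(** The trace part of a curvature tensor with projective Schouten tensor Q. *)
Definition schouten_term Q (a b c d : 'I_3) : R :=
  (a == c)%:R * Q b d - (b == c)%:R * Q a d + (Q b a - Q a b) * (d == c)%:R.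

(** The Schouten tensor changes by u_b u_d - nabla_b u_d when the connection
    is changed projectively by the one-form u. *)
Lemma riemann_proj (dG : 'I_3 -> comp3 R) (G : comp3 R) (u : 'I_3 -> R)
    (du : 'I_3 -> 'I_3 -> R) :
  (forall a b c, G a b c = G b a c) ->
  let G' : comp3 R := fun a d c => G a d c + u a * (d == c)%:R + (a == c)%:R * u d in
  let dG' : 'I_3 -> comp3 R := fun b a d c =>
    dG b a d c + du b a * (d == c)%:R + (a == c)%:R * du b d in
  exists Q, forall a b c d,
    riemann dG' G' a b c d = riemann dG G a b c d + schouten_term Q a b c d.
Proof.
move=> Gs G' dG'.
exists (\matrix_(b, d) (\sum_m G b d m * u m - du b d + u b * u d)) => a b c d.
rewrite /riemann /schouten_term !mxE /G' /dG' !sum3 /=.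
elim/ord3_ind: a; elim/ord3_ind: b; elim/ord3_ind: c; elim/ord3_ind: d => /=.
all: by rewrite ?(Gs i1 i0) ?(Gs i2 i0) ?(Gs i2 i1); ring.
Qed.

End CurvatureAlgebra.

Section MetricWeyl.
Variable R : realType.
Implicit Types (a b c d m : 'I_3).

(** The successor modulo 3: (i, next3 i, next3 (next3 i)) is an even permutation. *)
Definition next3 (a : 'I_3) : 'I_3 :=
  match nat_of_ord a with 0 => i1 | 1 => i2 | _ => i0 end.

(** In dimension 3 skew forms are dual to vectors. *)
Lemma skew_dual (t : 'I_3 -> 'I_3 -> R) : (forall a b, t b a = - t a b) ->
  forall a b, t a b = \sum_(i < 3) levi R a b i * t (next3 i) (next3 (next3 i)).
Proof.
move=> sk; have t0 a : t a a = 0 by have := sk a a; lra.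
have [[s10 s20] s21] := (sk i0 i1, sk i0 i2, sk i1 i2).
by elim/ord3_ind; elim/ord3_ind; rewrite sum3 /= /next3 /= ?t0; lra.
Qed.

Lemma curvature_dual (s : comp4 R) :
  (forall a b c d, s b a c d = - s a b c d) ->
  (forall a b c d, s a b d c = - s a b c d) ->
  (forall a b c d, s a b c d + s b c a d + s c a b d = 0) ->
  exists2 E : 'M[R]_3, E^T = E &
    forall a b c d, s a b c d = \sum_(i < 3) \sum_(j < 3) levi R a b i * levi R c d j * E i j.
Proof.
move=> sk1 sk2 cyc.
exists (\matrix_(i, j) s (next3 i) (next3 (next3 i)) (next3 j) (next3 (next3 j))).
  have z c d a : s c d a a = 0 by have := sk2 c d a a; lra.
  have c0 := cyc i0 i1 i2 i0; have c1 := cyc i0 i1 i2 i1; have c2 := cyc i0 i1 i2 i2.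
  have k0 := sk2 i2 i0 i0 i1; have k1 := sk2 i1 i2 i0 i1.
  have k2 := sk2 i0 i1 i0 i2.
  have k3 := sk2 i0 i1 i2 i0; have k4 := sk2 i1 i2 i2 i0; have k5 := sk2 i2 i0 i1 i2.
  have k6 := sk2 i0 i1 i1 i2.
  have [[z0 z1] z2] := (z i1 i2 i0, z i2 i0 i1, z i0 i1 i2).
  apply/matrixP; elim/ord3_ind; elim/ord3_ind; rewrite !mxE /next3 /=; lra.
move=> a b c d; rewrite (skew_dual (fun a b => sk1 a b c d)).
apply: eq_bigr => i _; rewrite (skew_dual (sk2 _ _)) mulr_sumr.
by apply: eq_bigr => j _; rewrite mxE mulrA.
Qed.

(** rho stands for the curvature of the Levi-Civita connection of g, and W for its
    trace-free part.  The trace of rho over its last two indices vanishes, so P is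
    symmetric and equals half the Ricci tensor; this expresses W, hence V, in terms
    of g and of the matrix E of curvature_dual. *)
Lemma metric_weyl (rho W : comp4 R) (g P : 'M[R]_3) (f : R) :
  g^T = g -> g \in unitmx -> trace_free W ->
  (forall a b c d, rho a b c d = W a b c d + schouten_term P a b c d) ->
  (forall a b c d, rho b a c d = - rho a b c d) ->
  (forall a b c d, rho a b c d + rho b d c a + rho d a c b = 0) ->
  (forall a b c d,
     \sum_m rho a b m c * g m d + \sum_m rho a b m d * g c m = 0) ->
  exists2 E : 'M[R]_3, E^T = E &
    Vtensor (fun a b c => f * levi R a b c) W = pencil E (invmx g).
Proof.
move=> gs gu [W1 _ W3] rhoE sk1 cyc sk2.
have gsE m d : g m d = g d m by rewrite -[in LHS]gs mxE.
pose s : comp4 R := fun a b c d => \sum_m rho a b m c * g m d.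
have s1 a b c d : s b a c d = - s a b c d.
  by rewrite /s -sumrN; apply: eq_bigr => m _; rewrite sk1 mulNr.
have s2 a b c d : s a b d c = - s a b c d.
  have := sk2 a b c d; rewrite -/(s a b c d) => /eqP; rewrite addrC addr_eq0 => /eqP <-.
  by apply: eq_bigr => m _; rewrite gsE.
have s3 a b c d : s a b c d + s b c a d + s c a b d = 0.
  rewrite /s -!big_split big1 // => m _ /=; rewrite -!mulrDl.
  by have := cyc a b m c => ->; rewrite mul0r.
have [E Es sE] := curvature_dual s1 s2 s3.
pose h := invmx g.
have hs : h^T = h by rewrite /h trmx_inv gs.
have hE m d : h m d = h d m by rewrite -[in LHS]hs mxE.
have rhoh a b m c : rho a b m c = \sum_d s a b c d * h d m.
  pose Q : 'M[R]_3 := \matrix_(k, l) rho a b l k.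
  have -> : rho a b m c = (Q *m g *m h) c m by rewrite /h mulmxK// mxE.
  rewrite mxE; apply: eq_bigr => d _; congr (_ * _); rewrite mxE.
  by apply: eq_bigr => e _; rewrite mxE.
have EE a b : E a b = E b a by rewrite -[in LHS]Es mxE.
(* The vector dual to rho in its first two indices; each of its components is a
   single 2 x 2 minor, which keeps the final identities small. *)
pose T i c m := \sum_(d < 3) \sum_(j < 3) levi R c d j * E i j * h d m.
have rhoT a b m c : rho a b m c = \sum_(i < 3) levi R a b i * T i c m.
  rewrite rhoh; under eq_bigr do rewrite sE mulr_suml.
  rewrite exchange_big; apply: eq_bigr => i _; rewrite mulr_sumr.
  apply: eq_bigr => d _; rewrite mulr_suml mulr_sumr.
  by apply: eq_bigr => j _; rewrite !mulrA.
have T0 i m : T i i0 m = E i i2 * h i1 m - E i i1 * h i2 m.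
  by rewrite /T !sum3 /=; ring.
have T1 i m : T i i1 m = E i i0 * h i2 m - E i i2 * h i0 m.
  by rewrite /T !sum3 /=; ring.
have T2 i m : T i i2 m = E i i1 * h i0 m - E i i0 * h i1 m.
  by rewrite /T !sum3 /=; ring.
have r0 a m c : rho a a m c = 0 by have := sk1 a a m c; lra.
have r01 m c : rho i0 i1 m c = T i2 c m by rewrite rhoT sum3 /=; ring.
have r12 m c : rho i1 i2 m c = T i0 c m by rewrite rhoT sum3 /=; ring.
have r20 m c : rho i2 i0 m c = T i1 c m by rewrite rhoT sum3 /=; ring.
have r10 m c : rho i1 i0 m c = - T i2 c m by rewrite sk1 r01.
have r21 m c : rho i2 i1 m c = - T i0 c m by rewrite sk1 r12.
have r02 m c : rho i0 i2 m c = - T i1 c m by rewrite sk1 r20.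
have rE := (r0, r01, r12, r20, r10, r21, r02, T0, T1, T2).
have hEE := (hE i1 i0, hE i2 i0, hE i2 i1, EE i1 i0, EE i2 i0, EE i2 i1).
have tr3 a b : \sum_c rho a b c c = 0.
  by rewrite sum3; elim/ord3_ind: a; elim/ord3_ind: b; rewrite !rE ?hEE; ring.
have Ps a b : P b a = P a b.
  have := tr3 a b; under eq_bigr do rewrite rhoE.
  rewrite big_split /= W3 add0r sum3 /schouten_term.
  elim/ord3_ind: a; elim/ord3_ind: b => /=; lra.
have PE b d : P b d = 2^-1 * \sum_a rho a b a d.
  under eq_bigr do rewrite rhoE.
  rewrite big_split /= W1 add0r sum3 /schouten_term.
  have [p10 [p20 p21]] := (Ps i0 i1, (Ps i0 i2, Ps i1 i2)).
  elim/ord3_ind: b; elim/ord3_ind: d => /=; lra.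
have WE a b c d : W a b c d
    = rho a b c d - (a == c)%:R * P b d + (b == c)%:R * P a d.
  by rewrite rhoE /schouten_term (Ps a b); ring.
(* The sign comes from the order of the indices of levi in pencil. *)
exists (\matrix_(a, b) (- f * E a b)); first by apply/matrixP => a b; rewrite !mxE EE.
rewrite -/h; apply/funext => a; apply/funext => b; apply/funext => c.
have -> : Vtensor (fun a b c => f * levi R a b c) W a b c
    = f * (W (next3 a) (next3 (next3 a)) b c - W (next3 (next3 a)) (next3 a) b c).
  by rewrite /Vtensor !sum3; elim/ord3_ind: a; rewrite /next3 /=; ring.
have -> : pencil (\matrix_(a, b) (- f * E a b)) h a b c =
    - f * ((E a (next3 c) * h (next3 (next3 c)) b + E b (next3 c) * h (next3 (next3 c)) a)
      - (E a (next3 (next3 c)) * h (next3 c) b + E b (next3 (next3 c)) * h (next3 c) a)).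
  by rewrite /pencil !sum3 !mxE; elim/ord3_ind: c; rewrite /next3 /=; ring.
elim/ord3_ind: a; elim/ord3_ind: b; elim/ord3_ind: c; rewrite /next3 /= !WE !PE /=.
all: by rewrite !sum3 !rE ?hEE; field.
Qed.

End MetricWeyl.

Section Metrizable.
Variable R : realType.

Lemma volume_levi (M : manifold3 R) eps i x : @is_volume R M eps -> img i x ->
  eps i x = fun a b c => eps i x i0 i1 i2 * levi R a b c.
Proof.
move=> [_ _ skew _] ix.
have sk1 a b c : eps i x b a c = - eps i x a b c by have [] := skew i x ix a b c.
have sk2 a b c : eps i x a c b = - eps i x a b c by have [] := skew i x ix a b c.
have z1 a c : eps i x a a c = 0 by have := sk1 a a c; lra.
have z2 a c : eps i x a c c = 0 by have := sk2 a c c; lra.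
have z3 a b : eps i x a b a = 0 by rewrite sk1 z2 oppr0.
have [e1 e2] := (sk2 i0 i1 i2, sk1 i0 i1 i2).
have [e3 [e4 e5]] := (sk1 i0 i2 i1, (sk2 i1 i0 i2, sk1 i1 i2 i0)).
apply/funext => a; apply/funext => b; apply/funext => c.
elim/ord3_ind: a; elim/ord3_ind: b; elim/ord3_ind: c;
  by rewrite /= ?(z1, z2, z3); lra.
Qed.

Lemma dgamma_proj (M : manifold3 R) (D D' : connection M)
    (u : chart M -> 'rV[R]_3 -> 'rV[R]_3) i x :
  (forall i x, img i x -> forall a d c, christoffel D' i a d c x
    = christoffel D i a d c x + u i x 0 a * (d == c)%:R + (a == c)%:R * u i x 0 d) ->
  is_oneform u -> img i x ->
  dgamma_at D' i x = fun b a d c => dgamma_at D i x b a d c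
    + partial b (fun y => u i y 0 a) x * (d == c)%:R
    + (a == c)%:R * partial b (fun y => u i y 0 d) x.
Proof.
move=> DD' [us _] ix; apply/funext => b; apply/funext => a; apply/funext => d.
apply/funext => c; have oi := @img_open _ _ i.
have uis e : smooth (img i) (fun y => u i y 0 e) := us i 0 e.
have cs k := @smooth_cst R (img i) k.
have chs := @christoffel_smooth _ _ D i a d c.
have eqn y (iy : img i y) := DD' i y iy a d c.
rewrite /dgamma_at (partial_congr b oi eqn ix).
rewrite (partialD b (V := img i)) ?(partialD b (V := img i)) ?(partialM b (V := img i))//.
- by rewrite !partial_cst mulr0 addr0 mul0r add0r.
- exact: smoothM.
- by apply: smoothD => //; exact: smoothM.
- exact: smoothM.
Qed.

(** rho is the curvature of the Levi-Civita connection D' projectively equivalent to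
    D; its Schouten tensor is P + Q, where P is that of D. *)
Lemma metrizable_weyl (M : manifold3 R) (D : connection M) W eps i x :
  torsion_free D -> is_weyl D W -> @is_volume R M eps -> proj_metrizable D -> img i x ->
  exists E h : 'M[R]_3, [/\ E^T = E, h^T = h & Vtensor (eps i x) (W i x) = pencil E h].
Proof.
move=> Dtf [Rm [P [DRm WP]]] epsV [g [D' [gM [D'tf D'g] DD']]] ix.
have [u [u1 uE]] := christoffel_proj DD'.
have [Wtf WE] := WP i x ix.
have Gs a b c : gamma_at D i x a b c = gamma_at D i x b a c by exact: christoffel_sym.
have G's a b c : gamma_at D' i x a b c = gamma_at D' i x b a c by exact: christoffel_sym.
have dG's := partial_christoffel_sym D'tf ix.
have G'E : gamma_at D' i x = fun a d c => gamma_at D i x a d c + u i x 0 a * (d == c)%:R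
    + (a == c)%:R * u i x 0 d.
  by apply/funext => a; apply/funext => d; apply/funext => c; exact: uE.
have dG'E := dgamma_proj uE u1 ix.
have [Q QE] := @riemann_proj R (dgamma_at D i x) (gamma_at D i x) (fun a => u i x 0 a)
  (fun b a => partial b (fun y => u i y 0 a) x) Gs.
rewrite -G'E -dG'E in QE.
have [_ _ gs gu] := gM.
have rhoE a b c d : riemann (dgamma_at D' i x) (gamma_at D' i x) a b c d
    = W i x a b c d + schouten_term (P i x + Q) a b c d.
  rewrite QE -(curvature_components DRm ix) WE /schouten_term !mxE; ring.
have [E Es VE] := metric_weyl (eps i x i0 i1 i2) (gs i x ix) (gu i x ix) Wtf rhoE
  (riemann_skew12 _ _) (riemann_cyclic G's dG's) (riemann_skew gM D'g ix).
exists E, (invmx (g i x)); split => //; first by rewrite trmx_inv gs.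
by rewrite (volume_levi epsV ix).
Qed.

Lemma metrizable_vanish (M : manifold3 R) (D : connection M) W eps :
  torsion_free D -> is_weyl D W -> @is_volume R M eps -> proj_metrizable D ->
  [/\ vanishes (@CB R) eps W, vanishes (@FD R) eps W, vanishes (@JL R) eps W,
      vanishes (@JCC R) eps W & vanishes (@JKAD R) eps W].
Proof.
move=> Dtf DW epsV Dm; split=> i x ix;
  have [E [h [Es hs ->]]] := metrizable_weyl Dtf DW epsV Dm ix;
  by have [] := pencil_vanish Es hs.
Qed.

End Metrizable.

(** * Connections with constant coefficients on R^3 *)

Section AffineSpace.
Variable R : realType.

(** The balls with rational centre and radius 1 / (n + 1) form a countable
    basis. *)
Lemma rV_second_countable n : @second_countable 'rV[R]_n.
Proof.
pose B (q : 'rV[rat]_n * nat) : set 'rV[R]_n :=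
  ball (map_mx (@ratr R) q.1) (q.2.+1%:R^-1 : R).
exists (range B); first exact: card_le_trans (card_image_le _ _) (countableP _).
split=> [_ [q _ <-]|x A /nbhs_ballP[e /= e0 xeA]]; first exact: ball_open.
have e20 : 0 < e / 2 by rewrite divr_gt0.
have [N _ /(_ N (leqnn N)) Ne] : \forall k \near \oo, (k.+1%:R^-1 : R) < e / 2.
  exact: near_infty_natSinv_lt (PosNum e20).
have r0 : 0 < N.+1%:R^-1 :> R by rewrite invr_gt0.
have /fin_all_exists[q qx] j : exists q : rat, `|ratr q - x 0 j| < N.+1%:R^-1.
  have /rat_in_itvoo[q] : x 0 j < x 0 j + N.+1%:R^-1 by rewrite ltrDl.
  rewrite in_itv /= => /andP[xq qx]; exists q.
  by rewrite gtr0_norm ?subr_gt0// ltrBlDl.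
have Bx : B (\row_j q j, N) x.
  by split=> // k j; rewrite ord1 !mxE /ball /= qx.
exists (B (\row_j q j, N)); first by split=> //; exists (\row_j q j, N).
move=> y By; apply: xeA; rewrite [e]splitr.
apply: (@ball_triangle _ _ (map_mx (@ratr R) (\row_j q j))).
  by apply/ball_sym/(le_ball (ltW Ne)).
exact: (le_ball (ltW Ne)).
Qed.

Let full_open : open ((fun x : 'rV[R]_3 => x) @` setT).
Proof. by rewrite image_id; exact: openT. Qed.

Let id_continuous (x : 'rV[R]_3) : {for x, continuous (fun y : 'rV[R]_3 => y)}.
Proof. exact: cvg_id. Qed.

Let id_smooth V : smooth_mx V ((fun x => x) \o (fun x : 'rV[R]_3 => x)).
Proof. by move=> k l; rewrite ord1; exact: smooth_coord. Qed.

Definition affine3 : manifold3 R := @Manifold3 R 'rV[R]_3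
  (@norm_hausdorff R 'rV[R]_3) (@rV_second_countable 3) unit
  (fun=> setT) (fun _ x => x) (fun _ x => x)
  (fun=> openT) (fun p => ex_intro _ tt I) (fun=> full_open) (fun _ _ _ => erefl)
  (fun _ x _ => @id_continuous x) (fun _ x _ => @id_continuous x)
  (fun _ _ => @id_smooth _).

End AffineSpace.

Section ConstantConnection.
Variables (R : realType) (G : comp3 R).
Implicit Types (X Y Z : 'rV[R]_3 -> 'rV[R]_3) (V : set 'rV[R]_3).

Definition constant_nabla X : 'rV[R]_3 -> 'M[R]_3 := fun x =>
  \matrix_(a, b) (partial a (fun y => X y 0 b) x + \sum_d X x 0 d * G a d b).

Lemma constant_nabla_smooth V X : open V -> smooth_mx V X -> smooth_mx V (constant_nabla X).
Proof.
move=> oV Xs a b; have -> : (fun x => constant_nabla X x a b) = fun x =>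
    partial a (fun y => X y 0 b) x + \sum_d X x 0 d * G a d b.
  by apply/funext => x; rewrite mxE.
apply: smoothD => //; first exact: smooth_partial (Xs 0 b).
by apply: smooth_sum => // d; apply: smoothM => //; exact: smooth_cst.
Qed.

Lemma constant_nabla_congr V X Y x : open V -> (forall y, V y -> X y = Y y) -> V x ->
  constant_nabla X x = constant_nabla Y x.
Proof.
move=> oV XY Vx; apply/matrixP => a b; rewrite !mxE XY//; congr (_ + _).
by apply: (partial_congr a oV _ Vx) => y Vy; rewrite XY.
Qed.

Lemma constant_nabla_add V X Y : smooth_mx V X -> smooth_mx V Y -> forall x, V x ->
  constant_nabla (X \+ Y) x = constant_nabla X x + constant_nabla Y x.
Proof.
move=> Xs Ys x Vx; apply/matrixP => a b; rewrite !mxE.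
have -> : (fun y => (X \+ Y) y 0 b) = fun y => X y 0 b + Y y 0 b.
  by apply/funext => y; rewrite mxE.
rewrite (partialD a (Xs 0 b) (Ys 0 b) Vx) addrACA -big_split /=; congr (_ + _).
by apply: eq_bigr => d _; rewrite mxE mulrDl.
Qed.

Lemma constant_nabla_leibniz V f X : smooth V f -> smooth_mx V X -> forall x, V x ->
  constant_nabla (fun y => f y *: X y) x = grad f x *m X x + f x *: constant_nabla X x.
Proof.
move=> fs Xs x Vx; apply/matrixP => a b; rewrite !mxE big_ord1 mxE.
have -> : (fun y => (f y *: X y) 0 b) = fun y => f y * X y 0 b.
  by apply/funext => y; rewrite mxE.
rewrite (partialM a fs (Xs 0 b) Vx) -addrA mulrDr; congr (_ + (_ + _)).
by rewrite mulr_sumr; apply: eq_bigr => d _; rewrite mxE mulrA.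
Qed.

Lemma affine_Jac i j x : @Jac R (affine3 R) i j x = 1%:M.
Proof.
apply/matrixP => a b; rewrite mxE [partial _ _ _](_ : _ = (b == a)%:R).
  by rewrite mxE eq_sym.
by rewrite -[RHS]/((fun=> (b == a)%:R) x) -partial_coord.
Qed.

Lemma affine_img i : @img R (affine3 R) i = setT.
Proof. exact: image_id. Qed.

Lemma constant_nabla_glue (i j : chart (affine3 R)) (U : set (affine3 R)) X Y :
  open U -> U `<=` Defs.dom i `&` Defs.dom j ->
  smooth_mx (Defs.phi i @` U) X -> smooth_mx (Defs.phi j @` U) Y ->
  (forall x, (Defs.phi i @` U) x -> X x *m Jac i j x = Y (transition i j x)) ->
  forall x, (Defs.phi i @` U) x ->
    constant_nabla X x *m Jac i j x = Jac i j x *m constant_nabla Y (transition i j x).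
Proof.
move=> oU _ _ _ XY x Ux; rewrite affine_Jac mulmx1 mul1mx.
have imU : Defs.phi i @` U = U by exact: image_id.
rewrite imU in XY Ux; apply: constant_nabla_congr oU _ Ux => y Uy.
by have := XY y Uy; rewrite affine_Jac mulmx1.
Qed.

Definition constant_connection : connection (affine3 R) :=
  @Connection R (affine3 R) (fun=> constant_nabla)
    (fun _ V X oV _ => constant_nabla_smooth oV)
    (fun _ V X Y _ _ => @constant_nabla_add V X Y)
    (fun _ V f X _ _ => @constant_nabla_leibniz V f X)
    constant_nabla_glue.

Lemma covE i X Y x c : cov constant_connection i X Y x 0 c
  = \sum_a X x 0 a * (partial a (fun y => Y y 0 c) x + \sum_d Y x 0 d * G a d c).
Proof. by rewrite mxE; apply: eq_bigr => a _; rewrite mxE. Qed.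

(** The identity [nabla_X, nabla_Y] Z - nabla_[X,Y] Z = R(X, Y) Z at one point:
    x, y, z are the values of the fields, dx, dy, dz their first derivatives, and
    h is the matrix of second derivatives of the component c of Z. *)
Lemma constant_ricci_identity (x y z : 'I_3 -> R) (dx dy dz h : 'I_3 -> 'I_3 -> R) c :
  (forall a b, h a b = h b a) ->
  let nz b m := dz b m + \sum_d z d * G b d m in
  let dnz a b := h a b + \sum_d dz a d * G b d c in
  \sum_a x a * (\sum_b (dy a b * nz b c + y b * dnz a b)
                + \sum_m (\sum_b y b * nz b m) * G a m c)
  - \sum_a y a * (\sum_b (dx a b * nz b c + x b * dnz a b)
                + \sum_m (\sum_b x b * nz b m) * G a m c)
  - \sum_b (\sum_a (x a * dy a b - y a * dx a b)) * nz b c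
  = \sum_a \sum_b \sum_d
      riemann (fun=> fun _ _ => 0) G a b c d * x a * y b * z d.
Proof.
move=> hs nz dnz; rewrite /dnz /nz /riemann.
rewrite !sum3 (hs i1 i0) (hs i2 i0) (hs i2 i1).
by ring.
Qed.

Hypothesis Gs : forall a b c, G a b c = G b a c.

Lemma constant_torsion_free : torsion_free constant_connection.
Proof.
move=> i X Y Xs Ys x _; apply/rowP => c; rewrite mxE [X in _ + X]mxE !covE mxE.
have key (v w p q : 'I_3 -> R) :
    \sum_a v a * (q a + \sum_d w d * G a d c)
    - \sum_a w a * (p a + \sum_d v d * G a d c) = \sum_a (v a * q a - w a * p a).
  by rewrite !sum3 (Gs i1 i0) (Gs i2 i0) (Gs i2 i1); ring.
exact: (key (X x 0) (Y x 0) (fun a => partial a (fun y => X y 0 c) x)).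
Qed.

Lemma constant_curvature :
  is_curvature constant_connection (fun _ _ => riemann (fun=> fun _ _ => 0) G).
Proof.
move=> i X Y Z; rewrite affine_img => Xs Ys Zs x _ c.
have oT : open [set: 'rV[R]_3] by exact: openT.
have cov_partial W a : smooth_mx setT W ->
  partial a (fun y => cov constant_connection i W Z y 0 c) x
  = \sum_b (partial a (fun y => W y 0 b) x *
        (partial b (fun y => Z y 0 c) x + \sum_d Z x 0 d * G b d c)
      + W x 0 b * (partial a (partial b (fun y => Z y 0 c)) x
        + \sum_d partial a (fun y => Z y 0 d) x * G b d c)).
  move=> Ws; have ZGs b d : smooth setT (fun y => Z y 0 d * G b d c).
    exact: smoothM oT (Zs 0 d) (@smooth_cst _ _ _).
  have Zcs b : smooth setT (partial b (fun y => Z y 0 c)) by exact/smooth_partial/(Zs 0 c).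
  have nZs b : smooth setT (fun y => partial b (fun y => Z y 0 c) y + \sum_d Z y 0 d * G b d c).
    by apply: smoothD => //; exact: smooth_sum.
  under eq_fun do rewrite covE.
  rewrite (@partial_sum _ setT (fun b y => W y 0 b * (partial b (fun y => Z y 0 c) y
    + \sum_d Z y 0 d * G b d c)))//; last by move=> b; exact: smoothM oT (Ws 0 b) (nZs b).
  apply: eq_bigr => b _; rewrite (partialM a (Ws 0 b) (nZs b))//; congr (_ + _ * _).
  rewrite (@partialD _ setT)//; last exact: smooth_sum.
  congr (_ + _); rewrite (@partial_sum _ setT (fun d y => Z y 0 d * G b d c))//.
  apply: eq_bigr => d _; rewrite (partialM a (Zs 0 d) (@smooth_cst _ _ _))//.
  by rewrite partial_cst mulr0 addr0.
have sub3 (A B C : 'rV[R]_3) : (A - B - C) 0 c = A 0 c - B 0 c - C 0 c.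
  by rewrite !mxE.
have bracketE b : lie_bracket X Y x 0 b = \sum_a (X x 0 a * partial a (fun y => Y y 0 b) x
    - Y x 0 a * partial a (fun y => X y 0 b) x) by rewrite mxE.
rewrite sub3 [in X in X - _ - _]covE [in X in _ - X - _]covE [in X in _ - _ - X]covE.
under eq_bigr do rewrite (cov_partial _ _ Ys).
under [X in _ - X - _]eq_bigr do rewrite (cov_partial _ _ Xs).
have comm a b : partial a (partial b (fun y => Z y 0 c)) x
    = partial b (partial a (fun y => Z y 0 c)) x.
  exact: partial_comm oT (Zs 0 c) _.
rewrite -(constant_ricci_identity (X x 0) (Y x 0) (Z x 0)
  (fun a b => partial a (fun y => X y 0 b) x) (fun a b => partial a (fun y => Y y 0 b) x)
  (fun a b => partial a (fun y => Z y 0 b) x) c comm).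
congr (_ - _ - _); apply: eq_bigr => a _; last by rewrite bracketE.
  by congr (_ * (_ + _)); apply: eq_bigr => m _; rewrite covE.
by congr (_ * (_ + _)); apply: eq_bigr => m _; rewrite covE.
Qed.

End ConstantConnection.

(** * An example where the five tensors do not vanish *)

Section Example.
Variable R : realType.

(** If x is an eigenvector of N(x) then w = l x, and by linearity all the rows
    that occur in the polynomials are multiples of x. *)
Lemma forms_eigen (N : 'rV[R]_3 -> 'M[R]_3) (x : 'rV[R]_3) l :
  (forall a u, N (a *: u) = a *: N u) -> x *m N x = l *: x ->
  [/\ formC N x = l * formA N x, formF N x = l ^+ 2 * formA N x, formD N x = l * formB N x,
      formL N x = l ^+ 3 * formB N x & formJ N x = l ^+ 4 * formA N x] /\
  formK N x = l ^+ 4 * formA N x.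
Proof.
move=> NZ xN; rewrite /formA /formB /formC /formD /formF /formJ /formK /formL !xN !NZ.
rewrite !(=^~ scalemxAl, =^~ scalemxAr, xN, NZ) !mxtraceZ.
by do !split; ring.
Qed.

Definition ex_gamma : comp3 R := fun a b c =>
  match nat_of_ord a, nat_of_ord b, nat_of_ord c with
  | 0, 1, 1 | 1, 0, 1 | 1, 2, 0 | 2, 1, 0 => 1
  | _, _, _ => 0
  end.

Definition ex_schouten : 'M[R]_3 := - 2^-1 *: delta_mx i0 i0.

Definition ex_weyl : comp4 R := fun a b c d =>
  riemann (fun=> fun _ _ => 0) ex_gamma a b c d - schouten_term ex_schouten a b c d.

Lemma ex_gamma_sym a b c : ex_gamma a b c = ex_gamma b a c.
Proof. by elim/ord3_ind: a; elim/ord3_ind: b; elim/ord3_ind: c. Qed.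

Lemma ex_weyl_trace_free : trace_free ex_weyl.
Proof.
rewrite /ex_weyl /riemann /schouten_term /ex_schouten.
split; elim/ord3_ind; elim/ord3_ind;
  by rewrite sum3 !mxE !sum3 /ex_gamma /=; field.
Qed.

Lemma ex_is_weyl : is_weyl (constant_connection ex_gamma) (fun _ _ => ex_weyl).
Proof.
exists (fun _ _ => riemann (fun=> fun _ _ => 0) ex_gamma), (fun _ _ => ex_schouten).
split; first exact: constant_curvature.
move=> i x _; split; first exact: ex_weyl_trace_free.
by move=> a b c d; rewrite /ex_weyl /schouten_term; ring.
Qed.

Lemma affine_volume : @is_volume R (affine3 R) (fun _ _ a b c => levi R a b c).
Proof.
split.
- by move=> i a b c; exact: smooth_cst.
- move=> i j x _ a b c; rewrite affine_Jac !sum3 !mxE.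
  by elim/ord3_ind: a; elim/ord3_ind: b; elim/ord3_ind: c => /=; ring.
- move=> i x _ a b c.
  by elim/ord3_ind: a; elim/ord3_ind: b; elim/ord3_ind: c => /=; rewrite ?opprK ?oppr0.
- by move=> i x _; exists i0, i1, i2; exact: oner_neq0.
Qed.

Lemma volume_neq0 (M : manifold3 R) eps i x : @is_volume R M eps -> img i x ->
  eps i x i0 i1 i2 != 0.
Proof.
move=> epsV ix; have [_ _ _ /(_ i x ix)[a [b [c abc0]]]] := epsV.
apply: contraNneq abc0 => f0.
by rewrite (volume_levi epsV ix) f0 mul0r.
Qed.

Lemma ex_contr (f : R) : let V := Vtensor (fun a b c => f * levi R a b c) ex_weyl in
  let e : 'rV[R]_3 := delta_mx 0 i0 in
  contr V e = f *: diag_mx (\row_j (if j == i0 then -2 else if j == i1 then 2 else 0)).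
Proof.
move=> V e; apply/matrixP => b c; rewrite mxE sum3 !mxE /= mul1r !mul0r !addr0.
rewrite /V /Vtensor !sum3 /= /ex_weyl /riemann /schouten_term /ex_schouten !mxE !sum3.
by elim/ord3_ind: b; elim/ord3_ind: c; rewrite /ex_gamma /=; field.
Qed.

Lemma ex_forms (f : R) :
  let N := contr (Vtensor (fun a b c => f * levi R a b c) ex_weyl) in
  let e : 'rV[R]_3 := delta_mx 0 i0 in
  [/\ formA N e = 8 * f ^+ 2, formB N e = 0, formC N e = - 16 * f ^+ 3, formD N e = 0 &
      formF N e = 32 * f ^+ 4] /\
  [/\ formJ N e = 128 * f ^+ 6, formK N e = 128 * f ^+ 6 & formL N e = 0].
Proof.
move=> N e; pose v : 'rV[R]_3 := \row_j (if j == i0 then -2 else if j == i1 then 2 else 0).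
have Ne : N e = f *: diag_mx v by exact: ex_contr.
have eN : e *m N e = (- 2 * f) *: e.
  rewrite Ne -scalemxAr -rowE row_diag_mx mxE /= scalerA; congr (_ *: _); ring.
have A8 : formA N e = 8 * f ^+ 2.
  rewrite /formA Ne -scalemxAl -scalemxAr mulmx_diag !mxtraceZ mxtrace_diag.
  by rewrite sum3 !mxE /=; ring.
have B0 : formB N e = 0.
  rewrite /formB Ne -!(scalemxAl, scalemxAr) !mulmx_diag !mxtraceZ mxtrace_diag.
  by rewrite sum3 !mxE /=; ring.
have [[-> -> -> -> ->] ->] := forms_eigen (contr_scale _) eN.
by rewrite A8 B0; do !split; ring.
Qed.

(** It is enough to test the polynomial at e^0 for all nonzero multiples of the
    standard eps, since any volume agrees with one of them at the origin. *)
Lemma nonvanishing k (T : comp3 R -> ctensor R k) :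
  (forall f, f != 0 ->
     hat (T (Vtensor (fun a b c => f * levi R a b c) ex_weyl)) (delta_mx 0 i0) != 0) ->
  generally_nonzero T.
Proof.
move=> Tn0; exists (affine3 R), (constant_connection ex_gamma), (fun _ _ => ex_weyl).
split; first exact: constant_torsion_free ex_gamma_sym.
- exact: ex_is_weyl.
- by exists (fun _ _ a b c => levi R a b c); exact: affine_volume.
move=> eps epsV T0; have i0img : img (M := affine3 R) tt 0 by rewrite affine_img.
have := Tn0 _ (volume_neq0 epsV i0img); apply/negP/negPn.
rewrite -(volume_levi epsV i0img) /hat big1// => t _.
by rewrite (T0 tt 0 i0img) mul0r.
Qed.

Lemma five_generally_nonzero :
  [/\ generally_nonzero (@CB R), generally_nonzero (@FD R), generally_nonzero (@JL R),
      generally_nonzero (@JCC R) & generally_nonzero (@JKAD R)].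
Proof.
split; apply: nonvanishing => f f0;
  have [[A B C D' F] [J K L]] := ex_forms f.
- rewrite hat_CB C B (_ : _ - _ = - 16 * f ^+ 3); last ring.
  by apply: mulf_neq0; [rewrite oppr_eq0 pnatr_eq0|exact: expf_neq0].
- rewrite hat_FD F D' (_ : _ - _ = 32 * f ^+ 4); last ring.
  by apply: mulf_neq0; [rewrite pnatr_eq0|exact: expf_neq0].
- rewrite hat_JL J L (_ : _ - _ = 128 * f ^+ 6); last ring.
  by apply: mulf_neq0; [rewrite pnatr_eq0|exact: expf_neq0].
- rewrite hat_JCC J C (_ : _ - _ = - 128 * f ^+ 6); last ring.
  by apply: mulf_neq0; [rewrite oppr_eq0 pnatr_eq0|exact: expf_neq0].
- rewrite hat_JKAD J K A D' (_ : _ + _ = - 384 * f ^+ 6); last ring.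
  by apply: mulf_neq0; [rewrite oppr_eq0 pnatr_eq0|exact: expf_neq0].
Qed.

End Example.

(** * The theorem *)

Theorem theorem1p2 (R : realType) :
  [/\ generally_nonzero (@CB R), generally_nonzero (@FD R), generally_nonzero (@JL R),
      generally_nonzero (@JCC R) & generally_nonzero (@JKAD R)] /\
  forall (M : manifold3 R) (D : connection M)
    (W : chart M -> 'rV[R]_3 -> comp4 R) (eps : chart M -> 'rV[R]_3 -> comp3 R),
    torsion_free D -> is_weyl D W -> is_volume eps -> proj_metrizable D ->
    [/\ vanishes (@CB R) eps W, vanishes (@FD R) eps W, vanishes (@JL R) eps W,
        vanishes (@JCC R) eps W & vanishes (@JKAD R) eps W].
Proof.
split; first exact: five_generally_nonzero.
exact: metrizable_vanish.
Qed.
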